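(* Let $s>3$ be an integer. Let $(\xi_n)_{n\ge 1}$ be a sequence of independent identically distributed random variables taking the values $0,1,\dots,s-1,s,s+1$ with probabilities $p_0,p_1,\dots,p_{s-1},p_s,p_{s+1}$ respectively, where $p_i\ge 0$, $p_i<1$, $\sum_{i=0}^{s+1}p_i=1$, and let $\xi=\sum_{n=1}^{\infty}s^{-n}\xi_n$. Then $\xi$ can be represented as the sum of two independent random variables, one of which is uniformly distributed on the interval $[0,1]$, if and only if $$p_1\ge p_0\quad\text{and}\quad p_2=p_3=\dots=p_{s-2}=p_{s-1}=p_0+p_s=p_1+p_{s+1}=\frac1s .$$
   Context: ''Can be represented as the sum of two independent random variables'' is understood at the level of distributions: there exist independent random variables $\tau,\eta$ (on some probability space), with $\tau$ uniformly distributed on $[0,1]$, such that $\tau+\eta$ has the same distribution as $\xi$. *)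

(* Defs.v *)
From HB Require Import structures.
From mathcomp Require Import all_boot all_order all_algebra finmap.
From mathcomp Require Import all_classical all_reals all_analysis.

Set Implicit Arguments.
Unset Strict Implicit.
Unset Printing Implicit Defensive.

Import Order.TTheory GRing.Theory Num.Theory.
Import numFieldNormedType.Exports.

Local Open Scope classical_set_scope.
Local Open Scope ring_scope.

Definition mutually_independent (d : measure_display) (T : measurableType d)
    (R : realType) (P : probability T R) (I : choiceType)
    (X : I -> {RV P >-> R}) : Prop :=
  forall (J : {fset I}) (A : I -> set R), (forall i, measurable (A i)) ->
    P (\bigcap_(i in [set` J]) (X i @^-1` A i)) =
    (\prod_(i <- J) P (X i @^-1` A i))%E.

Definition independent2 (d : measure_display) (T : measurableType d)
    (R : realType) (P : probability T R) (X Y : {RV P >-> R}) : Prop :=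
  forall A B : set R, measurable A -> measurable B ->
    P ((X @^-1` A) `&` (Y @^-1` B)) =
    (P (X @^-1` A) * P (Y @^-1` B))%E.

Definition uniform01 (d : measure_display) (T : measurableType d)
    (R : realType) (P : probability T R) (X : {RV P >-> R}) : Prop :=
  forall A : set R, measurable A ->
    distribution P X A = uniform_prob (@ltr01 R) A.

(* The summands may live on another probability space than [X]: only the
   distribution of [X] is decomposed. *)
Definition has_uniform_summand (d : measure_display) (T : measurableType d)
    (R : realType) (P : probability T R) (X : {RV P >-> R}) : Prop :=
  exists (d' : measure_display) (T' : measurableType d')
      (P' : probability T' R) (tau eta : {RV P' >-> R}),
    [/\ independent2 tau eta,
        uniform01 tau &
        forall A : set R, measurable A ->
          pushforward P' (tau \+ eta) A =
          distribution P X A].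

(* The sum of the series is only required almost surely, so [xi] may be any
   version of it; [xin n] is the coefficient of [s ^- n.+1]. *)
Definition is_radix_sum (d : measure_display) (T : measurableType d)
    (R : realType) (P : probability T R) (s : nat)
    (xin : nat -> {RV P >-> R}) (xi : {RV P >-> R}) : Prop :=
  {ae P, forall w,
     series (fun n => s%:R ^- n.+1 * xin n w : R) @ \oo --> xi w}.

(* Main.v *)
(* The law [mu] of [xi] is the unique one carried by a bounded interval whose
   cdf F satisfies the refinement equation F x = sum_k p_k F (s x - k), so
   everything can be read off F.

   Necessity: a uniform summand kills the Fourier coefficients of [mu] at
   2 pi m for m >= 1. As phi (s t) = f (t) phi (t) with f (t) = sum_k p_k e^(ikt)
   and phi <> 0 near 0, for each m there is k >= 1 such that e^(2 i pi m / s^k)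
   is a root of sum_k p_k X^k. This polynomial has at most s + 1 roots; counting
   them forces, for s > 3, all nontrivial s-th roots of unity to be among them,
   which says that the sums of the p_k over the residue classes mod s agree.
   Since the other summand is nonnegative, F (x + 1/s) - F x is nondecreasing
   for small x; comparing the increments of F over two intervals, where the
   refinement equation has a single nonzero term, gives p_0 <= p_1.

   Sufficiency: then sum_k p_k X^k = (1 + X + ... + X^(s-1)) (a + b X + c X^2)
   with a, b, c >= 0, and [mu] is the convolution of the uniform law, whose
   digits are uniform on [0, s), with the law whose digits 0, 1, 2 have
   probabilities s a, s b, s c. *)

Require Import Defs.
From HB Require Import structures.
From mathcomp Require Import all_boot all_order all_algebra finmap.
From mathcomp Require Import all_classical all_reals all_analysis.
From mathcomp Require Import measurable_realfun complex ring lra zify.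

Set Implicit Arguments.
Unset Strict Implicit.
Unset Printing Implicit Defensive.

Import Order.TTheory GRing.Theory Num.Theory.
Import numFieldNormedType.Exports.

Local Open Scope classical_set_scope.
Local Open Scope ring_scope.

(** * Distribution functions of radix expansions *)

Definition refinable (R : realType) (s K : nat) (p : nat -> R) (F : R -> R) :=
  forall x, F x = \sum_(k < K) p k * F (s%:R * x - k%:R).

(** Distribution function of the sum of the first [n] digits, started from the Dirac mass at 0 and
    unfolded on the leading digit. *)
Fixpoint digit_cdf (R : realType) (s K : nat) (p : nat -> R) n (x : R) : R :=
  if n is m.+1 then \sum_(k < K) p k * digit_cdf s K p m (s%:R * x - k%:R)
  else (0 <= x)%R%:R.

Definition radix_cdf (R : realType) (s K : nat) (p : nat -> R) (x : R) : R :=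
  lim (digit_cdf s K p n x @[n --> \oo]).

Section RadixCdf.
Context {R : realType}.
Variables (s K : nat) (p : nat -> R) (B : R).
Hypothesis s_gt1 : (1 < s)%N.
Hypothesis p_ge0 : forall k, (k < K)%N -> 0 <= p k.
Hypothesis p_sum : \sum_(k < K) p k = 1.
Hypothesis B_ge0 : 0 <= B.
(** The interval [0, B] is mapped into itself by every contraction x -> (k + x) / s. *)
Hypothesis B_stable : forall k, (k < K)%N -> k%:R + B <= s%:R * B.

Local Notation D := (digit_cdf s K p).
Local Notation N := (radix_cdf s K p).

Let s_gt0 : 0 < s%:R :> R. Proof. by rewrite ltr0n; apply: ltn_trans s_gt1. Qed.

Lemma le_digit_cdf n : {homo D n : x y / x <= y}.
Proof.
elim: n => [|n IH] x y xy /=.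
  by case: (leP 0 x) => [x0|_]; rewrite ?(le_trans x0 xy)//=; exact: ler0n.
apply: ler_sum => k _; apply: ler_wpM2l; first exact: p_ge0.
by apply: IH; rewrite lerD2r ler_pM2l.
Qed.

Lemma digit_cdf_ge0 n x : 0 <= D n x.
Proof.
elim: n x => [|n IH] x /=; first exact: ler0n.
by apply: sumr_ge0 => k _; rewrite mulr_ge0 ?p_ge0.
Qed.

Lemma digit_cdf_le1 n x : D n x <= 1.
Proof.
elim: n x => [|n IH] x /=; first by case: (0 <= x)%R.
rewrite -p_sum; apply: ler_sum => k _.
by rewrite ler_piMr ?p_ge0.
Qed.

Lemma digit_cdf_lt0 n x : x < 0 -> D n x = 0.
Proof.
elim: n x => [|n IH] x x0 /=; first by rewrite leNgt x0.
rewrite big1// => k _; rewrite IH ?mulr0//.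
have : s%:R * x < 0 by rewrite pmulr_rlt0.
by have : 0 <= k%:R :> R := ler0n _ _; lra.
Qed.

Lemma digit_cdf_ge n x : B <= x -> D n x = 1.
Proof.
elim: n x => [|n IH] x Bx /=; first by rewrite (le_trans B_ge0 Bx).
rewrite -[RHS]p_sum; apply: eq_bigr => k _; rewrite IH ?mulr1//.
rewrite lerBrDr addrC (le_trans (B_stable (ltn_ord k)))//.
by rewrite ler_pM2l.
Qed.

(** Appending a nonnegative digit can only increase the sum. The first step is checked directly, and
    the refinement operator preserves the inequality. *)
Lemma digit_cdf_nonincr x : nonincreasing_seq (fun n => D n x).
Proof.
apply/nonincreasing_seqP => n; elim: n x => [|n IH] x.
  case: (ltP x 0) => x0; first by rewrite digit_cdf_lt0// digit_cdf_ge0.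
  by rewrite [leRHS]/= x0 digit_cdf_le1.
by apply: ler_sum => k _; apply: ler_wpM2l; [exact: p_ge0|exact: IH].
Qed.

(** Finitely many digits give a right-continuous step function; this is what passes right continuity
    on to the limit. *)
Lemma digit_cdf_step n x :
  exists2 e, 0 < e & forall y, x <= y < x + e -> D n y = D n x.
Proof.
elim: n x => [|n IH] x.
  case: (leP 0 x) => x0 /=.
    exists 1; rewrite ?ltr01// => y /andP[xy _].
    by rewrite x0 (le_trans x0 xy).
  exists (- x); rewrite ?oppr_gt0// => y; rewrite subrr => /andP[_ y0].
  by rewrite !leNgt x0 y0.
have /choice[e /all_and2 [e0 eP]] (k : 'I_K) : exists e, 0 < e /\
    forall y, s%:R * x - k%:R <= y < s%:R * x - k%:R + e ->
      D n y = D n (s%:R * x - k%:R).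
  by have [e e0 eP] := IH (s%:R * x - k%:R); exists e.
pose d := \big[Num.min/1]_(k < K) e k.
have d0 : 0 < d by rewrite /d; elim/big_ind: _ => // a b a0 b0; rewrite lt_min a0.
exists (d / s%:R); first by rewrite divr_gt0.
move=> y /andP[xy yd] /=; apply: eq_bigr => k _; congr (_ * _); apply: eP.
have : d <= e k by rewrite /d (bigD1 k)//= ge_min lexx.
have : s%:R * x <= s%:R * y by rewrite ler_pM2l.
have : s%:R * y < s%:R * x + d.
  have -> : s%:R * x + d = s%:R * (x + d / s%:R) by field; rewrite gt_eqF.
  by rewrite ltr_pM2l.
by move=> *; lra.
Qed.

Lemma digit_cdf_cvg x : D n x @[n --> \oo] --> N x.
Proof.
apply: nonincreasing_is_cvgn; first exact: digit_cdf_nonincr.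
by exists 0 => _ [n _ <-]; exact: digit_cdf_ge0.
Qed.

Lemma radix_cdf_le n x : N x <= D n x.
Proof.
apply: nonincreasing_cvgn_ge; first exact: digit_cdf_nonincr.
by apply/cvg_ex; exists (N x); exact: digit_cdf_cvg.
Qed.

Lemma radix_cdf_ge0 x : 0 <= N x.
Proof.
apply: limr_ge; first by apply/cvg_ex; exists (N x); exact: digit_cdf_cvg.
by near=> n; exact: digit_cdf_ge0.
Unshelve. all: by end_near. Qed.

Lemma radix_cdf_lt0 x : x < 0 -> N x = 0.
Proof.
move=> x0; apply/eqP; rewrite eq_le radix_cdf_ge0 andbT.
by rewrite -(digit_cdf_lt0 0 x0) radix_cdf_le.
Qed.

Lemma radix_cdf_ge x : B <= x -> N x = 1.
Proof.
move=> Bx; apply: cvg_lim => //.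
under eq_fun do rewrite digit_cdf_ge//; exact: cvg_cst.
Qed.

Lemma le_radix_cdf : {homo N : x y / x <= y}.
Proof.
move=> x y xy; apply: ler_lim.
- by apply/cvg_ex; exists (N x); exact: digit_cdf_cvg.
- by apply/cvg_ex; exists (N y); exact: digit_cdf_cvg.
- by near=> n; exact: le_digit_cdf.
Unshelve. all: by end_near. Qed.

Lemma radix_cdf_refinable : refinable s K p N.
Proof.
move=> x; apply: cvg_lim => //; rewrite -cvg_shiftS /=.
apply: cvg_big => // [|k _]; first exact: add_continuous.
by apply: cvgMr; exact: digit_cdf_cvg.
Qed.

Lemma radix_cdf_right_continuous : right_continuous N.
Proof.
move=> x; apply/cvgrPdist_lt => e e0.
have /cvgrPdist_lt/(_ _ e0)[n _ nP] := @digit_cdf_cvg x.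
have [d d0 dP] := digit_cdf_step n x.
near=> y.
have xy : x < y by near: y; exact: nbhs_right_gt.
rewrite ler0_norm ?subr_le0 ?le_radix_cdf ?ltW// opprB.
(* The chain is [N y <= D n y = D n x < N x + e]. *)
apply: le_lt_trans (nP n (leqnn n)).
rewrite ler0_norm ?subr_le0 ?radix_cdf_le// opprB lerD2r.
rewrite -(dP y) ?radix_cdf_le// ltW//=.
by near: y; apply: nbhs_right_lt; rewrite ltrDl.
Unshelve. all: by end_near. Qed.

(* The two-sided bound [D n (x - B / s ^+ n) <= F x <= D n x] pins [F] down. *)
Lemma refinable_unique (F : R -> R) :
  refinable s K p F -> {homo F : x y / x <= y} -> right_continuous F ->
  (forall x, x < 0 -> F x = 0) -> (forall x, B <= x -> F x = 1) -> F = N.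
Proof.
move=> Fref Fmono Frc F0 F1.
have Fge0 x : 0 <= F x.
  have := Fmono (Num.min x (-1)) x; rewrite ge_min lexx => /(_ isT).
  by rewrite F0// gt_min ltrN10 orbT.
have Fle1 x : F x <= 1.
  have := Fmono x (Num.max x B); rewrite le_max lexx => /(_ isT).
  by rewrite (F1 (Num.max x B))// le_max lexx orbT.
have upper n x : F x <= D n x.
  elim: n x => [|n IH] x /=.
    case: (ltP x 0) => x0; [by rewrite F0|exact: Fle1].
  rewrite Fref; apply: ler_sum => k _; apply: ler_wpM2l => //; exact: p_ge0.
have lower n x : D n (x - B / s%:R ^+ n) <= F x.
  elim: n x => [|n IH] x.
    rewrite expr0 divr1 /=.
    by case: (leP 0 (x - B)); rewrite ?subr_ge0 => // Bx; rewrite F1.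
  rewrite Fref /=; apply: ler_sum => k _; apply: ler_wpM2l; first exact: p_ge0.
  rewrite (_ : _ - _ = s%:R * x - k%:R - B / s%:R ^+ n)//.
  by rewrite exprS; field; rewrite expf_neq0 gt_eqF.
apply/funext => x; apply/eqP; rewrite eq_le; apply/andP; split.
  apply: limr_ge; first by apply/cvg_ex; exists (N x); exact: digit_cdf_cvg.
  by near=> n; exact: upper.
apply/ler_addgt0Pr => e e0.
have /cvgrPdist_lt/(_ _ e0)[d /= d0 dP] := Frc x.
have [n] : exists n, B / s%:R ^+ n < d.
  have s_lt1 : `|s%:R^-1 : R| < 1.
    by rewrite ger0_norm ?invr_ge0// invf_lt1 ?ltr1n.
  have /cvgr0Pnorm_lt/(_ _ d0)[n _ nP] := cvg_geometric B s_lt1.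
  exists n; have := nP n (leqnn n); rewrite /geometric /= exprVn.
  by rewrite ger0_norm// divr_ge0// exprn_ge0.
(* The right limit only sees points other than [x], so a zero shift is treated apart. Otherwise
   [lower] at [x + B / s ^+ n] bounds [D n x] by a value of [F] that is within [e] of [F x]. *)
move=> Bd; have [B0|B0] := eqVneq B 0.
  apply: (le_trans (radix_cdf_le n x)).
  by have := lower n x; rewrite B0 mul0r subr0 => /le_trans; apply; lra.
apply: (le_trans (radix_cdf_le n x)).
have := lower n (x + B / s%:R ^+ n); rewrite addrK => /le_trans; apply.
have Bn : 0 < B / s%:R ^+ n by rewrite divr_gt0 ?exprn_gt0// lt_def B0.
have := dP (x + B / s%:R ^+ n); rewrite /= opprD addNKr normrN ger0_norm; last lra.
move=> /(_ Bd); rewrite ltrDl => /(_ Bn).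
by rewrite ltr_distl => /andP[]; lra.
Unshelve. all: by end_near. Qed.

End RadixCdf.

(** * Self-similar laws *)

Lemma measurable_closed_rays (R : realType) :
  @measurable _ R =
  <<s [set A : set R | exists x, A = `]-oo, x]%classic] >>.
Proof.
rewrite eqEsubset; split; last first.
  apply: smallest_sub => [|_ [x ->]]; first exact: sigma_algebra_measurable.
  exact: measurable_itv.
rewrite [X in X `<=` _](RGenOInfty.measurableE R).
apply: smallest_sub; first exact: smallest_sigma_algebra.
move=> _ [x ->]; rewrite -setCitvl -setTD.
have [_ + _] := smallest_sigma_algebra setT
  [set A : set R | exists x, A = `]-oo, x]%classic].
by apply; apply: sub_sigma_algebra; exists x.
Qed.

(** Closed rays form a pi-system generating the Borel sets. [m2] is a plain measure so that a
    weighted sum of image measures qualifies. *)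
Lemma measure_eq_cdf (R : realType) (m1 : probability R R)
    (m2 : {measure set R -> \bar R}) :
  (forall x : R, m1 `]-oo, x]%classic = m2 `]-oo, x]%classic) ->
  forall A, measurable A -> m1 A = m2 A.
Proof.
move=> m12 A mA.
apply: (@measure_unique _ R R
  [set A : set R | exists x, A = `]-oo, x]%classic]
  (fun n => `]-oo, n%:R]%classic)) => //.
- exact: measurable_closed_rays.
- move=> _ _ [x ->] [y ->]; exists (Num.min x y).
  by apply/seteqP; split => z /=; rewrite !in_itv/= le_min => /andP.
- by move=> n; exists n%:R.
- apply/seteqP; split => // x _; have [n _ /(_ n) xn] := nbhs_infty_ger (x:R).
  by exists n => //=; rewrite in_itv/= xn/=.
- by move=> _ [x ->]; exact: m12.
- by move=> n; rewrite (le_lt_trans (probability_le1 m1 _)) ?ltry//; exact: measurable_itv.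
Qed.

Definition prepend_digit (R : realType) (s k : nat) : R -> R :=
  fun x : R => (k%:R + x) / s%:R.

Lemma measurable_prepend_digit (R : realType) (s k : nat) :
  measurable_fun setT (@prepend_digit R s k).
Proof. by apply: measurable_funM => //; exact: measurable_funD. Qed.

HB.instance Definition _ (R : realType) (s k : nat) :=
  isMeasurableFun.Build _ _ _ _ (@prepend_digit R s k) (@measurable_prepend_digit R s k).

Section SelfSimilar.
Context {R : realType}.
Variables (s K : nat) (p : nat -> R) (mu : probability R R).
Hypothesis s_gt0 : (0 < s)%N.
Hypothesis p_ge0 : forall k, (k < K)%N -> 0 <= p k.
Hypothesis mu_cdf : forall x : R, mu `]-oo, x]%classic =
  (\sum_(k < K) (p k)%:E * mu `]-oo, (s%:R * x - k%:R)%R]%classic)%E.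

(** [mscale] wants a nonnegative factor for every [k]; the absolute value supplies one and agrees
    with [p k] when [k < K]. *)
Let m k : {measure set R -> \bar R} :=
  mscale (NngNum (normr_ge0 (p k))) (distribution mu (@prepend_digit R s k)).

Let mE k A : (k < K)%N ->
  m k A = ((p k)%:E * mu [set x : R | A ((k%:R + x) / s%:R)%R])%E.
Proof.
move=> kK; rewrite (_ : m k A = `|p k|%:E * mu (@prepend_digit R s k @^-1` A))%E//.
by rewrite ger0_norm ?p_ge0.
Qed.

Let self_similar_msum A : measurable A -> mu A = msum m K A.
Proof.
apply: measure_eq_cdf => x; rewrite mu_cdf /msum; apply: eq_bigr => k _.
rewrite mE//; congr (_ * mu _)%E.
by apply/seteqP; split => y /=; rewrite !in_itv/=;
  rewrite ler_pdivrMr ?ltr0n// [x * _]mulrC lerBrDl.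
Qed.

(** By comparison of distribution functions, [mu] is the mixture with weights [p k] of its images
    under [prepend_digit], and the integral splits accordingly. *)
Lemma ge0_self_similar_integral (f : R -> \bar R) :
  measurable_fun setT f -> (forall x, 0 <= f x)%E ->
  (\int[mu]_x f x =
   \sum_(k < K) (p k)%:E * \int[mu]_x f ((k%:R + x) / s%:R)%R)%E.
Proof.
move=> mf f0.
rewrite (eq_measure_integral (msum m K)); last by move=> A mA _; exact: self_similar_msum.
rewrite ge0_integral_measure_sum//; apply: eq_bigr => k _.
rewrite (_ : (p k)%:E = `|p k|%:E); last by rewrite ger0_norm ?p_ge0.
by rewrite /m ge0_integral_mscale// ge0_integral_distribution.
Qed.

End SelfSimilar.

(** * The law of the radix sum *)

Lemma le_measure_ae d (T : measurableType d) (R : realType)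
    (mu : {measure set T -> \bar R}) (A B : set T) :
  measurable A -> measurable B -> {ae mu, forall w, A w -> B w} -> (mu A <= mu B)%E.
Proof.
move=> mA mB [N [mN N0 ABN]].
have AB : A `<=` B `|` N.
  move=> w Aw; have [Bw|nBw] := pselect (B w); [by left|right].
  by apply: ABN => /(_ Aw).
apply: (@le_trans _ _ (mu (B `|` N))).
  by apply: le_measure; rewrite ?inE//; exact: measurableU.
by rewrite measureU0.
Qed.

Lemma measurable_preimage_mfun d (T : measurableType d) (R : realType)
  (X : {mfun T >-> R}) (A : set R) : measurable A -> measurable (X @^-1` A).
Proof. by move=> mA; rewrite -[X in measurable X]setTI; exact: measurable_funP. Qed.

Section DiscreteVariable.
Context d (T : measurableType d) (R : realType) (P : probability T R).
Variables (X : {RV P >-> R}) (K : nat) (p : nat -> R).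
Hypothesis X_p : forall k, (k < K)%N -> P (X @^-1` [set k%:R]) = (p k)%:E.
Hypothesis p_sum : \sum_(k < K) p k = 1.

Let U : set T := \big[setU/set0]_(k < K) X @^-1` [set k%:R].

Let mX k : measurable (X @^-1` [set k%:R : R]).
Proof. exact: measurable_preimage_mfun. Qed.

Let mU : measurable U.
Proof. by apply: bigsetU_measurable. Qed.

Let trivX F : trivIset setT (fun k : nat => F `&` X @^-1` [set k%:R : R]).
Proof.
apply/trivIsetP => i j _ _ ij; apply/seteqP; split => // w [[_ /= ->]] [_ /eqP].
by rewrite eqr_nat (negbTE ij).
Qed.

Let PU_sum F : measurable F ->
  P (F `&` U) = (\sum_(k < K) P (F `&` X @^-1` [set k%:R]))%E.
Proof.
move=> mF; rewrite /U big_distrr/=.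
apply: (measure_bigsetU P (F := fun k : nat => F `&` X @^-1` [set k%:R : R])).
  by move=> k; exact: measurableI.
exact: trivX.
Qed.

Let PU : P U = 1%E.
Proof.
rewrite -[U]setTI PU_sum//; under eq_bigr do rewrite setTI X_p//.
by rewrite sumEFin p_sum.
Qed.

Let PUC F : measurable F -> P (F `&` ~` U) = 0%E.
Proof.
move=> mF; apply/eqP; rewrite eq_le measure_ge0 andbT.
apply: (@le_trans _ _ (P (~` U))).
  by apply: le_measure; rewrite ?inE//; [apply: measurableI => //|]; exact: measurableC.
by rewrite probability_setC// PU subee.
Qed.

(** The values below [K] already carry total mass 1, so the complement of [U] is null. *)
Lemma probability_digit_split (F : set T) : measurable F ->
  P F = (\sum_(k < K) P (F `&` X @^-1` [set k%:R]))%E.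
Proof.
move=> mF; rewrite -PU_sum// -[in LHS](setIT F) -(setUv U) setIUr.
have mFUC : measurable (F `&` ~` U) by apply: measurableI => //; exact: measurableC.
by rewrite measureU0//; [exact: measurableI|exact: PUC].
Qed.

Lemma ae_digit_ge0 : {ae P, forall w, 0 <= X w}.
Proof.
exists (~` U); split; [exact: measurableC| by rewrite -[~` U]setTI; exact: PUC|].
apply: subsetC => w; rewrite /U -(bigcup_mkord K (fun k => X @^-1` [set k%:R])).
by case=> k _ /= ->; exact: ler0n.
Qed.

End DiscreteVariable.

Section RadixSum.
Context (R : realType) d (T : measurableType d) (P : probability T R).
Variables (s K : nat) (p : nat -> R) (xin : nat -> {RV P >-> R}) (xi : {RV P >-> R}).
Hypothesis s_gt0 : (0 < s)%N.
Hypothesis p_sum : \sum_(k < K) p k = 1.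
Hypothesis xin_indep : mutually_independent xin.
Hypothesis xin_p : forall n k, (k < K)%N -> P (xin n @^-1` [set k%:R]) = (p k)%:E.

Local Notation D := (digit_cdf s K p).

Let tail m n w : R := \sum_(j < n) s%:R ^- j.+1 * xin (m + j)%N w.

Let measurable_tail m n : measurable_fun setT (tail m n).
Proof.
by apply: measurable_sum => j; apply: measurable_funM => //; exact: measurable_funP.
Qed.

Let mle m n x : measurable [set w | tail m n w <= x].
Proof.
rewrite -[X in measurable X]setTI.
have := @measurable_tail m n measurableT `]-oo, x]%classic (measurable_itv _).
by congr (measurable (_ `&` _)); apply/seteqP; split => w; rewrite /= in_itv.
Qed.

Let tailS m n w : tail m n.+1 w = (xin m w + tail m.+1 n w) / s%:R.
Proof.
rewrite /tail big_ord_recl/= addn0 expr1 mulrDl mulrC; congr (_ + _).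
rewrite mulr_suml; apply: eq_bigr => j _; rewrite /bump/= add1n addnS addSn.
by rewrite (exprS _ j.+1) invfM; ring.
Qed.

Let cyl (J : {fset nat}) (k : nat -> nat) : set T :=
  \bigcap_(i in [set` J]) (xin i @^-1` [set (k i)%:R]).

Let mcyl J k : measurable (cyl J k).
Proof.
apply: fin_bigcap_measurable => [|i _]; first exact: finite_fset.
exact: measurable_preimage_mfun.
Qed.

Let cylE J k : P (cyl J k) = (\prod_(i <- J) P (xin i @^-1` [set (k i)%:R]))%E.
Proof. by rewrite /cyl xin_indep. Qed.

(* Conditioning on finitely many earlier digits is what makes the induction
   on the length of the tail go through. *)
Let cyl_tail n m (J : {fset nat}) k x : (forall i, i \in J -> (i < m)%N) ->
  P (cyl J k `&` [set w | tail m n w <= x]) = (P (cyl J k) * (D n x)%:E)%E.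
Proof.
elim: n m J k x => [|n IH] m J k x Jm.
  have -> : [set w | tail m 0 w <= x] = if 0 <= x then setT else set0.
    rewrite (_ : [set w | _] = [set _ | (0 <= x)%R]); last first.
      by apply/funext => w; rewrite /= /tail big_ord0.
    by case: ifP => x0; apply/seteqP; split.
  by rewrite /=; case: ifP => _; rewrite ?setIT ?setI0 ?mule1 ?mule0 ?measure0.
have mJ : m \notin J by apply/negP => /Jm; rewrite ltnn.
have mF : measurable (cyl J k `&` [set w | tail m n.+1 w <= x]).
  by apply: measurableI; [exact: mcyl|exact: mle].
rewrite (probability_digit_split (xin_p m) p_sum mF).
have /fineK PJ : P (cyl J k) \is a fin_num by exact: fin_num_measure.
rewrite -PJ [D _ _]/= -EFinM mulr_sumr -sumEFin; apply: eq_bigr => c _.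
(* [k'] also prescribes the value [c] to digit [m]: the event becomes a cylinder over [J] and [m],
   intersected with a shorter tail starting at [m.+1]. *)
pose k' i := if i == m then (c : nat) else k i.
have cylS : cyl (m |` J)%fset k' = (xin m @^-1` [set c%:R]) `&` cyl J k.
  apply/seteqP; split => w.
    move=> cw; split; first by have := cw m; rewrite /= /k' eqxx; apply; rewrite fsetU11.
    move=> i /= iJ; have := cw i; rewrite /= /k'; case: eqP => [im|_].
      by move: mJ; rewrite -im iJ.
    by apply; rewrite in_fsetU iJ orbT.
  move=> [/= wm cw] i /=; rewrite in_fset1U /k'; case: eqP => [->//|_ /=]; exact: cw.
have PcylS : P (cyl (m |` J)%fset k') = (fine (P (cyl J k)) * p c)%:E.
  rewrite cylE big_fsetU1//= {1}/k' eqxx xin_p// muleC EFinM PJ cylE; congr (_ * _)%E.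
  rewrite big_seq [RHS]big_seq; apply: eq_bigr => i iJ; rewrite /k'.
  by case: eqP => // im; move: mJ; rewrite -im iJ.
rewrite mulrA EFinM -PcylS -(IH m.+1); last first.
  by move=> i; rewrite in_fset1U => /predU1P[->//|/Jm /ltnW]; rewrite ltnS.
congr (P _); rewrite cylS; apply/seteqP; split => w /=.
  move=> [[cw]]; rewrite tailS ler_pdivrMr ?ltr0n// => wx wc.
  by do !split => //; rewrite lerBrDl -wc mulrC.
move=> [[wc cw]] wx; do !split => //.
by rewrite tailS ler_pdivrMr ?ltr0n// wc mulrC -lerBrDl.
Qed.

Hypothesis s_gt1 : (1 < s)%N.
Hypothesis xin_xi : is_radix_sum s xin xi.

Let good : set T := \bigcap_n [set w | 0 <= xin n w].

Let mgood : measurable good.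
Proof.
apply: bigcapT_measurable => n.
have -> : [set w | 0 <= xin n w] = xin n @^-1` `[0, +oo[%classic.
  by apply/seteqP; split => w; rewrite /= in_itv/= andbT.
exact: measurable_preimage_mfun.
Qed.

Let ae_good : {ae P, forall w, good w}.
Proof.
have : {ae P, forall w, forall n, 0 <= xin n w}.
  by apply/ae_foralln => n; exact: ae_digit_ge0 (xin_p n) p_sum.
by apply: filterS => w gw n _; exact: gw.
Qed.

Let ae_tail : {ae P, forall w, tail 0 n w @[n --> \oo] --> xi w}.
Proof.
apply: filterS xin_xi => w; apply: cvg_trans; apply: near_eq_cvg; near=> n.
by rewrite /tail seriesEord /=; apply: eq_bigr => j _; rewrite add0n.
Unshelve. all: by end_near. Qed.

Let tail_nondecr w : good w -> nondecreasing_seq (fun n => tail 0 n w).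
Proof.
move=> gw; apply/nondecreasing_seqP => n.
rewrite /tail big_ord_recr/= lerDl mulr_ge0 ?invr_ge0 ?exprn_ge0//.
exact: gw.
Qed.

Hypothesis p_ge0 : forall k, (k < K)%N -> 0 <= p k.

(** Nonnegative digits make the truncations increase to [xi], so up to a null set the event xi <= x
    is the decreasing intersection of the [F n]; continuity from above turns [D n x] into its
    limit. *)
Lemma cdf_radix_sum x :
  P (xi @^-1` `]-oo, x]%classic) = (radix_cdf s K p x)%:E.
Proof.
pose F n := good `&` [set w | tail 0 n w <= x].
have mF n : measurable (F n) by apply: measurableI.
have PF n : P (F n) = (D n x)%:E.
  have := @cyl_tail n 0 fset0 (fun=> 0%N) x.
  rewrite cylE big_seq_fset0 mul1e => <-//.
  have -> : cyl fset0 (fun=> 0%N) = setT by apply/seteqP; split.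
  rewrite setTI; apply/eqP; rewrite eq_le; apply/andP; split.
    by apply: le_measure; rewrite ?inE//; exact: subIsetr.
  by apply: le_measure_ae => //; apply: filterS ae_good.
have niF : nonincreasing_seq F.
  move=> m n mn; apply/subsetPset => w [gw /= wx]; split => //=.
  by apply: le_trans wx; exact: tail_nondecr.
have cF : measurable (\bigcap_n F n) by exact: bigcapT_measurable.
have FN : P \o F @ \oo --> (radix_cdf s K p x)%:E.
  rewrite (_ : P \o F = EFin \o (fun n => D n x)); last exact/funext.
  by apply: cvg_EFin; [near=> n|]; rewrite //; exact: digit_cdf_cvg.
have F0y : (P (F 0%N) < +oo)%E by rewrite (le_lt_trans (probability_le1 P (mF 0%N))) ?ltry.
have PcF := nonincreasing_cvg_mu F0y mF cF niF.
rewrite -(cvg_unique _ PcF FN)//.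
apply/eqP; rewrite eq_le; apply/andP; split; apply: le_measure_ae => //.
- exact: measurable_preimage_mfun.
- apply: filterS2 ae_good ae_tail => w gw wxi; rewrite /= in_itv/= => xix n _.
  split => //=; apply: le_trans xix; rewrite -(cvg_lim _ wxi)//.
  apply: nondecreasing_cvgn_le; first exact: tail_nondecr.
  by apply/cvg_ex; exists (xi w).
- exact: measurable_preimage_mfun.
- apply: filterS ae_tail => w wxi Fw; rewrite /= in_itv/= -(cvg_lim _ wxi)//.
  apply: limr_le; first by apply/cvg_ex; exists (xi w).
  by near=> n; have [] := Fw n I.
Unshelve. all: by end_near. Qed.

End RadixSum.

(** * Convolution with the uniform law *)

Lemma integral_indicT d (T : measurableType d) (R : realType)
    (mu : {measure set T -> \bar R}) (A : set T) :
  measurable A -> (\int[mu]_x (\1_A x)%:E = mu A)%E.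
Proof. by move=> mA; rewrite integral_indic// setIT. Qed.

(** The distribution function of the uniform law on [0, 1]. *)
Definition clamp01 (R : realType) (x : R) : R := Num.min (Num.max x 0) 1.

Lemma integral_probability_cst d (T : measurableType d) (R : realType)
    (P : probability T R) (c : R) : (\int[P]_x (cst c%:E x) = c%:E)%E.
Proof.
by rewrite integral_cst// -[RHS]mule1; congr (_ * _)%E; exact: probability_setT.
Qed.

(* The library puts the uniform and the Lebesgue-Stieltjes measures on
   [measurableTypeR R], whereas random variables take their values in [R]
   itself: same Borel sets, different measurable structures. *)
Definition from_borel (R : realType) : measurableTypeR R -> R := idfun.

Lemma measurable_from_borel (R : realType) : measurable_fun setT (@from_borel R).
Proof. by move=> _ B mB; rewrite setTI. Qed.

HB.instance Definition _ (R : realType) :=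
  isMeasurableFun.Build _ _ _ _ (@from_borel R) (@measurable_from_borel R).

Definition uniform01_law (R : realType) : probability R R :=
  distribution (uniform_prob (@ltr01 R)) (@from_borel R).

Section Clamp.
Context {R : realType}.
Implicit Types x y : R.

Lemma clamp01_ge0 x : 0 <= clamp01 x.
Proof. by rewrite le_min le_max lexx orbT ler01. Qed.

Lemma clamp01_le1 x : clamp01 x <= 1.
Proof. by rewrite ge_min lexx orbT. Qed.

Lemma clamp01_le0 x : x <= 0 -> clamp01 x = 0.
Proof. by move=> x0; rewrite /clamp01 max_r// min_l. Qed.

Lemma clamp01_ge1 x : 1 <= x -> clamp01 x = 1.
Proof. by move=> x1; rewrite /clamp01 max_l ?min_r//; lra. Qed.

Lemma clamp01_id x : 0 <= x <= 1 -> clamp01 x = x.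
Proof. by move=> /andP[x0 x1]; rewrite /clamp01 max_l// min_l. Qed.

Variant clamp01_spec x : R -> Type :=
| ClampLow of x <= 0 : clamp01_spec x 0
| ClampMid of 0 <= x & x <= 1 : clamp01_spec x x
| ClampHigh of 1 <= x : clamp01_spec x 1.

Lemma clamp01P x : clamp01_spec x (clamp01 x).
Proof.
case: (leP x 0) => [x0|/ltW x0]; first by rewrite clamp01_le0//; constructor.
case: (leP x 1) => [x1|/ltW x1]; last by rewrite clamp01_ge1//; constructor.
by rewrite clamp01_id ?x0//; constructor.
Qed.

Lemma le_clamp01 : {homo @clamp01 R : x y / x <= y}.
Proof. by move=> x y xy; case: (clamp01P x); case: (clamp01P y); lra. Qed.

Lemma clamp01_lipschitz x y : x <= y -> clamp01 y <= clamp01 x + (y - x).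
Proof. by move=> xy; case: (clamp01P x); case: (clamp01P y); lra. Qed.

Lemma measurable_clamp01 : measurable_fun setT (@clamp01 R).
Proof.
by apply: measurable_minr => //; exact: measurable_maxr.
Qed.

Lemma measurable_clamp01B x :
  measurable_fun setT (fun y : R => (clamp01 (x - y))%:E).
Proof.
apply/measurable_EFinP; apply: (measurableT_comp measurable_clamp01).
exact: measurable_funB.
Qed.

Lemma uniform01_cdf x :
  uniform01_law R `]-oo, x]%classic = (clamp01 x)%:E.
Proof.
rewrite [LHS](_ : _ = uniform_prob (@ltr01 R) `]-oo, x]%classic)//.
rewrite /uniform_prob integral_uniform_pdf.
rewrite (eq_integral (cst 1%E)); last first.
  move=> y /[!inE] -[_]; rewrite /= in_itv/= => y01.
  by rewrite /uniform_pdf y01 subr0 invr1.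
rewrite integral_cst//=; last by apply: measurableI; exact: measurable_itv.
rewrite mul1e (_ : _ `&` _ = `[0, Num.min x 1]%classic); last first.
  by apply/seteqP; split => y; rewrite /= !in_itv/= le_min; lra.
rewrite lebesgue_measure_itv/= lte_fin.
case: (clamp01P x) => [x0|x0 x1|x1].
- by rewrite min_l ?ltNge ?x0//; lra.
- rewrite min_l// oppr0 adde0; case: ltP => // x0'.
  by congr EFin; lra.
- by rewrite min_r// ltr01 oppr0 adde0.
Qed.

End Clamp.

Section IndependentSum.
Context {R : realType} d (T : measurableType d) (P : probability T R).
Variables (tau eta : {RV P >-> R}).
Hypothesis tau_eta : independent2 tau eta.
Hypothesis tau_unif : uniform01 tau.

Local Notation U := (uniform01_law R).
Local Notation nu := (distribution P eta).

Let pair_fun w := (tau w, eta w).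

Let measurable_pair : measurable_fun setT pair_fun.
Proof.
by apply: measurable_fun_pair; [exact: (measurable_funPT tau)|exact: (measurable_funPT eta)].
Qed.

Let pair_mixin := isMeasurableFun.Build _ _ _ _ pair_fun measurable_pair.
Let pair_mfun : {mfun T >-> (R * R)%type} := HB.pack pair_fun pair_mixin.

(** Independence identifies the joint law of [tau] and [eta] with the product measure, by uniqueness
    on rectangles; Tonelli does the rest. *)
Lemma ge0_integral_uniform_sum (f : R -> \bar R) :
  measurable_fun setT f -> (forall x, 0 <= f x)%E ->
  (\int[distribution P (tau \+ eta)%R]_x f x =
   \int[nu]_y \int[U]_x f (x + y)%R)%E.
Proof.
move=> mf f0.
rewrite ge0_integral_distribution//.
pose g (z : R * R) : \bar R := f (z.1 + z.2)%R.
have mg : measurable_fun setT g.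
  apply: (measurableT_comp mf).
  by apply: measurable_funD; [exact: measurable_fst|exact: measurable_snd].
transitivity (\int[distribution P pair_mfun]_z g z)%E.
  by rewrite ge0_integral_distribution// => z; exact: f0.
transitivity (\int[U \x nu]_z g z)%E.
  apply: eq_measure_integral => A mA _; apply/esym.
  apply: product_measure_unique => // B C mB mC.
  by rewrite /= -tau_unif// -tau_eta.
by rewrite fubini_tonelli2// => z; exact: f0.
Qed.

Lemma uniform_sum_cdf x :
  P ((tau \+ eta) @^-1` `]-oo, x]%classic) =
  (\int[nu]_y (clamp01 (x - y))%:E)%E.
Proof.
have mI : measurable `]-oo, x]%classic by exact: measurable_itv.
rewrite -[LHS]/(distribution P (tau \+ eta) _) -[LHS]integral_indicT//.
rewrite ge0_integral_uniform_sum; last 2 first.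
- by apply/measurable_EFinP; exact: measurable_indic.
- by move=> y; rewrite lee_fin.
apply: eq_integral => y _; rewrite -uniform01_cdf -integral_indicT//.
apply: eq_integral => z _; rewrite !indicE.
suff -> : (z + y \in `]-oo, x]%classic) = (z \in `]-oo, x - y]%classic) by [].
by apply/idP/idP; rewrite !inE/= !in_itv/=; lra.
Qed.

End IndependentSum.

Section UniformConvolution.
Context {R : realType}.
Variable nu : probability R R.

(** Distribution function of the sum of a uniform variable and an independent variable of law [nu].
    [fine] loses nothing, as the integrand is bounded by 1. *)
Definition convolution_cdf (x : R) : R := fine (\int[nu]_y (clamp01 (x - y))%:E).

Let m_clamp := @measurable_clamp01B R.

Lemma convolution_cdfE x : (convolution_cdf x)%:E = (\int[nu]_y (clamp01 (x - y))%:E)%E.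
Proof.
rewrite fineK// ge0_fin_numE; last first.
  by apply: integral_ge0 => y _; rewrite lee_fin clamp01_ge0.
apply: (@le_lt_trans _ _ (\int[nu]_y (cst 1%:E y))%E).
  apply: ge0_le_integral => //.
  - by move=> y _; rewrite lee_fin clamp01_ge0.
  - by move=> y _; rewrite lee_fin clamp01_le1.
by rewrite integral_probability_cst ltry.
Qed.

Lemma le_convolution_cdf : {homo convolution_cdf : x y / x <= y}.
Proof.
move=> x y xy; rewrite -lee_fin !convolution_cdfE; apply: ge0_le_integral => //.
- by move=> z _; rewrite lee_fin clamp01_ge0.
- by move=> z _; rewrite lee_fin le_clamp01// lerD2r.
Qed.

Lemma convolution_cdf_lipschitz x y : x <= y ->
  convolution_cdf y <= convolution_cdf x + (y - x).
Proof.
move=> xy; rewrite -lee_fin EFinD !convolution_cdfE.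
have <- : (\int[nu]_z (cst (y - x)%:E z) = (y - x)%:E)%E.
  exact: integral_probability_cst.
have yx0 z : (0 <= cst (y - x)%:E z :> \bar R)%E by rewrite lee_fin subr_ge0.
have clamp0 t z : (0 <= (clamp01 (t - z))%:E :> \bar R)%E by rewrite lee_fin clamp01_ge0.
rewrite -ge0_integralD//.
apply: ge0_le_integral => //.
- by apply: emeasurable_funD.
- move=> z _; rewrite -EFinD lee_fin.
  by have := @clamp01_lipschitz R (x - z) (y - z); lra.
Qed.

Lemma convolution_cdf_right_continuous : right_continuous convolution_cdf.
Proof.
move=> x; apply/cvgrPdist_lt => e e0; near=> y.
have xy : x <= y by apply: ltW; near: y; exact: nbhs_right_gt.
rewrite ler0_norm ?subr_le0 ?le_convolution_cdf// opprB.
have yx : y - x < e.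
  by rewrite ltrBlDl; near: y; apply: nbhs_right_lt; rewrite ltrDl.
by have := convolution_cdf_lipschitz xy; lra.
Unshelve. all: by end_near. Qed.

(** The uniform summand is nonnegative. *)
Lemma convolution_cdf_le (x : R) : ((convolution_cdf x)%:E <= nu `]-oo, x]%classic)%E.
Proof.
have mI : measurable `]-oo, x]%classic by exact: measurable_itv.
rewrite convolution_cdfE -[leRHS]integral_indicT//.
apply: ge0_le_integral => //.
- by move=> y _; rewrite lee_fin clamp01_ge0.
- by apply/measurable_EFinP; exact: measurable_indic.
- move=> y _; rewrite lee_fin indicE.
  case: (boolP (y \in _)) => [_|]; first exact: clamp01_le1.
  by rewrite notin_setE/= in_itv/= => yx; rewrite clamp01_le0//; lra.
Qed.

(** With probability [c] the uniform summand is at most [c]. The value 1 is used to see where the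
    convolution reaches 1, and 1/2 to locate the support of [nu]. *)
Lemma convolution_cdf_ge (x c : R) : 0 <= c <= 1 ->
  (c%:E * nu `]-oo, (x - c)%R]%classic <= (convolution_cdf x)%:E)%E.
Proof.
move=> c01.
have mI : measurable `]-oo, x - c]%classic by exact: measurable_itv.
have c0 : (0 <= c%:E)%E by rewrite lee_fin; lra.
have mind : measurable_fun setT (fun y : R => (\1_`]-oo, (x - c)%R]%classic y)%:E : \bar R).
  by apply/measurable_EFinP; exact: measurable_indic.
rewrite convolution_cdfE -[nu _]integral_indicT// -ge0_integralZl//.
apply: ge0_le_integral => //.
- by move=> y _; rewrite mule_ge0.
- by apply: emeasurable_funM.
- move=> y _; rewrite -EFinM lee_fin indicE.
  case: (boolP (y \in _)) => [|_]; last by rewrite mulr0 clamp01_ge0.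
  by rewrite inE/= in_itv/= => yx; case: (clamp01P (x - y)); lra.
Qed.

End UniformConvolution.

Section ConvolutionIncrement.
Context {R : realType}.
Variable nu : probability R R.
Local Notation G := (convolution_cdf nu).

Let m_clamp := @measurable_clamp01B R.

Let clamp_ge0 (x y : R) : (0 <= (clamp01 (x - y))%:E :> \bar R)%E.
Proof. by rewrite lee_fin clamp01_ge0. Qed.

(* When [nu] is carried by ]-1/2, +oo[, the density of its convolution with the
   uniform law is nondecreasing up to 1/2. *)
Lemma convolution_cdf_increment (a b e : R) :
  (nu `]-oo, (- 2^-1)%R]%classic = 0)%E -> 0 <= e -> a <= b -> b + e <= 2^-1 ->
  G b + G (a + e) <= G (b + e) + G a.
Proof.
move=> nu0 e0 ab be; pose I := `]-oo, (- 2^-1 : R)]%classic.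
have mI : measurable I by exact: measurable_itv.
(* For [y] in [I] the pointwise inequality between the four clamps may fail, but its left side is at
   most 2: adding [2 * \1_I], of integral 0, repairs it. *)
have mind : measurable_fun setT (fun y : R => (2 * \1_I y)%:E : \bar R).
  by apply/measurable_EFinP; apply: measurable_funM => //; exact: measurable_indic.
have ind0 y : (0 <= (2 * \1_I y)%:E :> \bar R)%E by rewrite lee_fin mulr_ge0.
have int0 : (\int[nu]_y (2 * \1_I y)%:E = 0)%E.
  under eq_integral do rewrite EFinM.
  rewrite ge0_integralZl//; last by apply/measurable_EFinP; exact: measurable_indic.
  by rewrite integral_indicT//= nu0 mule0.
rewrite -lee_fin !EFinD !convolution_cdfE -[leRHS]adde0 -int0.
rewrite -!ge0_integralD//.
- apply: ge0_le_integral => //.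
  + by move=> y _; rewrite adde_ge0.
  + by apply: emeasurable_funD.
  + by apply: emeasurable_funD => //; apply: emeasurable_funD.
  + move=> y _; rewrite -!EFinD lee_fin indicE.
    case: (boolP (y \in I)) => [_|].
      rewrite mulr1; have := @clamp01_le1 R (b - y); have := @clamp01_le1 R (a + e - y).
      have := @clamp01_ge0 R (b + e - y); have := @clamp01_ge0 R (a - y); lra.
    rewrite notin_setE /I/= in_itv/= => y2.
    case: (clamp01P (b - y)); case: (clamp01P (a + e - y));
      case: (clamp01P (b + e - y)); case: (clamp01P (a - y)); lra.
- by move=> y _; rewrite adde_ge0.
- by apply: emeasurable_funD.
Qed.

End ConvolutionIncrement.

(** * The inequality between the first two digit probabilities *)

Section Monotonicity.
Context {R : realType}.
Variables (s : nat) (p : nat -> R) (nu : probability R R) (F : R -> R).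
Hypothesis s_gt3 : (3 < s)%N.
Hypothesis p_ge0 : forall k, (k < s.+2)%N -> 0 <= p k.
Hypothesis p0_lt1 : p 0%N < 1.
Hypothesis p_mid : forall k : nat, (2 <= k <= s.-1)%N -> p k = s%:R^-1.
Hypothesis F_refinable : refinable s s.+2 p F.
Hypothesis F_mono : {homo F : x y / x <= y}.
Hypothesis F_lt0 : forall x, x < 0 -> F x = 0.
Hypothesis F_ge : forall x, 5 / 3 <= x -> F x = 1.
Hypothesis F_conv : forall x, F x = convolution_cdf nu x.

Let s_ge4 : 4 <= s%:R :> R. Proof. by rewrite (ler_nat R 4). Qed.

Let s_gt0 : 0 < s%:R :> R. Proof. exact: lt_le_trans s_ge4. Qed.

(** At 0 the refinement equation reduces to F 0 = p_0 F 0, and p_0 < 1. *)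
Let F0 : F 0 = 0.
Proof.
have := F_refinable 0; rewrite big_ord_recl/= mulr0 subr0 big1 ?addr0.
  move=> F0; have /eqP : (1 - p 0%N) * F 0 = 0 by rewrite mulrBl mul1r -F0 subrr.
  by rewrite mulf_eq0 subr_eq0 => /orP[/eqP p1|/eqP//]; have := p0_lt1; rewrite -p1 ltxx.
move=> k _; rewrite F_lt0 ?mulr0// sub0r oppr_lt0 ltr0n//.
Qed.

Let F_le0 x : x <= 0 -> F x = 0.
Proof. by rewrite le_eqVlt => /predU1P[->|/F_lt0]. Qed.

Let F_diff (a b : R) : F b - F a =
  \sum_(k < s.+2) p k * (F (s%:R * b - k%:R) - F (s%:R * a - k%:R)).
Proof.
rewrite (F_refinable b) (F_refinable a) -sumrB.
by apply: eq_bigr => k _; rewrite mulrBr.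
Qed.

Let F_diff_ge k (a b : R) : (k < s.+2)%N -> a <= b ->
  p k * (F (s%:R * b - k%:R) - F (s%:R * a - k%:R)) <= F b - F a.
Proof.
move=> ks ab; rewrite [leRHS]F_diff [leRHS](bigD1 (Ordinal ks))//= lerDl.
apply: sumr_ge0 => i _; rewrite mulr_ge0 ?p_ge0// subr_ge0 F_mono//.
by rewrite lerD2r ler_pM2l.
Qed.

(** Digit [s - 1] on [2/3, 5/3] gives 1 - F (2/3) >= 1/s, and digit [s - 2] on [2/3, 1] gives F 1 -
    F (2/3) >= (1 - F (2/3)) / s. The second uses 2 - s/3 <= 2/3, that is s >= 4. *)
Let F_23 : F (2 / 3) < F 1.
Proof.
have s0 : 0 < s%:R^-1 :> R by rewrite invr_gt0.
have s4 := s_ge4.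
have nat_sub j : (j <= s)%N -> (s - j)%N%:R = s%:R - j%:R :> R by exact: natrB.
have s2 : p (s - 2)%N = s%:R^-1 by apply: p_mid; lia.
have s1 : p (s - 1)%N = s%:R^-1 by apply: p_mid; lia.
have h1 := @F_diff_ge (s - 1) (2 / 3) (5 / 3) ltac:(lia) ltac:(lra).
have h2 := @F_diff_ge (s - 2) (2 / 3) 1 ltac:(lia) ltac:(lra).
move: h1 h2; rewrite s1 s2 !nat_sub; [|lia|lia].
rewrite (@F_ge (5 / 3)); last lra.
rewrite (@F_ge (s%:R * (5 / 3) - (s%:R - 1%:R))); last lra.
rewrite (@F_le0 (s%:R * (2 / 3) - (s%:R - 1%:R))); last lra.
rewrite (@F_ge (s%:R * 1 - (s%:R - 2%:R))); last lra.
have : F (s%:R * (2 / 3) - (s%:R - 2%:R)) <= F (2 / 3) by apply: F_mono; lra.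
by nra.
Qed.

Lemma refinable_convolution_le01 : p 0%N <= p 1%N.
Proof.
have s0 := s_gt0; have s4 := s_ge4.
(* The lower bound for the convolution at 0 with [c] = 1/2 shows that half this mass is at most F 0
   = 0. *)
have nu0 : (nu `]-oo, (- 2^-1)%R]%classic = 0)%E.
  have := @convolution_cdf_ge R nu 0 2^-1 ltac:(lra).
  rewrite -F_conv F0 sub0r => h; apply/eqP; rewrite eq_le measure_ge0 andbT.
  by move: h; rewrite pmule_rle0// lte_fin; lra.
(* After scaling by [s], the interval [a, b] becomes [2/3, 1] and its translate by 1/s becomes
   [5/3, 2]. Only digit 0 sees the first and only digit 1 the second, both with the factor F 1 - F
   (2/3), which [F_23] makes positive. The bound b + 1/s <= 1/2 holds as s >= 4. *)
pose a : R := 2 / 3 / s%:R; pose b : R := s%:R^-1.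
have s4' : s%:R^-1 <= 4^-1 :> R by rewrite lef_pV2 ?posrE//; lra.
have ab : a <= b by rewrite /a /b ler_piMl ?invr_ge0//; lra.
have := convolution_cdf_increment nu0 (ltW (_ : 0 < s%:R^-1)) ab.
rewrite invr_gt0 => /(_ s0); rewrite {1}/b => /(_ ltac:(lra)).
rewrite -!F_conv => inc.
have sa : s%:R * a = 2 / 3 by rewrite /a; field; lra.
have sb : s%:R * b = 1 by rewrite /b; field; lra.
have sae : s%:R * (a + s%:R^-1) = 5 / 3 by rewrite /a; field; lra.
have sbe : s%:R * (b + s%:R^-1) = 2 by rewrite /b; field; lra.
have d1 : F b - F a = p 0%N * (F 1 - F (2 / 3)).
  rewrite F_diff sa sb big_ord_recl/= !subr0 big1 ?addr0// => k _.
  have : 1 <= (lift ord0 k)%:R :> R by rewrite ler1n.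
  by move=> k1; rewrite !F_le0 ?subrr ?mulr0//; lra.
have d2 : F (b + s%:R^-1) - F (a + s%:R^-1) = p 1%N * (F 1 - F (2 / 3)).
  rewrite F_diff sae sbe 2!big_ord_recl/= !subr0 !(@F_ge (5 / 3)) ?(@F_ge 2); [|lra|lra].
  rewrite subrr mulr0 add0r big1 ?addr0 => [|k _].
    by congr (_ * (F _ - F _)); rewrite /bump/=; lra.
  have : 2 <= (lift ord0 (lift ord0 k))%:R :> R by rewrite (ler_nat R 2).
  by move=> k1; rewrite !F_le0 ?subrr ?mulr0//; lra.
by have := F_23; nra.
Qed.

End Monotonicity.

(** * Refinement equation of the convolution, and sufficiency *)

Section UniformDigits.
Context {R : realType}.

(** The [i]-th term is the length of the part of [0, y] lying in [i, i + 1]. *)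
Lemma sum_clamp01 n (y : R) :
  \sum_(i < n) clamp01 (y - i%:R) = Num.min (Num.max y 0) n%:R.
Proof.
elim: n => [|n IH]; first by rewrite big_ord0 min_r// le_max lexx orbT.
rewrite big_ord_recr/= IH -(natr1 n) /clamp01.
have n0 : 0 <= n%:R :> R := ler0n _ _; move: n%:R n0 => m m0.
rewrite !(maxEle, minEle); case: (leP y 0) => ?; case: (leP (y - m) 0) => ?;
  by do !case: leP => ?; lra.
Qed.

(** The uniform law is itself a radix law, with digits uniform on 0, ..., s - 1. *)
Lemma clamp01_digits s (y : R) : (0 < s)%N ->
  clamp01 y = \sum_(i < s) s%:R^-1 * clamp01 (s%:R * y - i%:R).
Proof.
rewrite -(ltr0n R) => s0; rewrite -mulr_sumr sum_clamp01.
case: (clamp01P y) => [y0|y0 y1|y1].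
- have sy : s%:R * y <= 0 by rewrite pmulr_rle0.
  by rewrite max_r// min_l ?mulr0// ltW.
- have sy0 : 0 <= s%:R * y by rewrite mulr_ge0// ltW.
  have sys : s%:R * y <= s%:R by rewrite ler_piMr// ltW.
  by rewrite max_l// min_l// mulKf// gt_eqF.
- have sy : s%:R <= s%:R * y by rewrite ler_peMr// ltW.
  by rewrite max_l ?(le_trans (ltW s0))// min_r// mulVf ?gt_eqF.
Qed.

End UniformDigits.

Section ConvolutionRefinable.
Context {R : realType}.
Variables (s K : nat) (q : nat -> R) (nu : probability R R).
Hypothesis s_gt0 : (0 < s)%N.
Hypothesis q_ge0 : forall k, (k < K)%N -> 0 <= q k.
Hypothesis nu_cdf : forall x : R, nu `]-oo, x]%classic =
  (\sum_(k < K) (q k)%:E * nu `]-oo, (s%:R * x - k%:R)%R]%classic)%E.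
Local Notation G := (convolution_cdf nu).

Let m_clamp := @measurable_clamp01B R.

(** Both factors are split on their leading digits: [j] for [nu], [i] for the uniform law. *)
Lemma convolution_cdf_digits x :
  G x = \sum_(j < K) q j * \sum_(i < s) s%:R^-1 * G (s%:R * x - j%:R - i%:R).
Proof.
have s0 : 0 < s%:R :> R by rewrite ltr0n.
apply: EFin_inj; rewrite convolution_cdfE.
rewrite (ge0_self_similar_integral s_gt0 q_ge0 nu_cdf)//; last first.
  by move=> y; rewrite lee_fin clamp01_ge0.
rewrite -sumEFin; apply: eq_bigr => j _; rewrite EFinM; congr (_ * _)%E.
transitivity (\int[nu]_y \sum_(i < s)
    (s%:R^-1%:E * (clamp01 (s%:R * x - j%:R - i%:R - y))%:E))%E.
  apply: eq_integral => y _; rewrite (clamp01_digits _ s_gt0) -sumEFin.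
  apply: eq_bigr => i _; rewrite EFinM; congr (_ * (clamp01 _)%:E)%E.
  by field; rewrite gt_eqF.
rewrite ge0_integral_sum//; last 2 first.
- by move=> i; apply: emeasurable_funM.
- by move=> i y _; rewrite mule_ge0// lee_fin ?clamp01_ge0// invr_ge0 ltW.
have sV0 : (0 <= (s%:R^-1 : R)%:E)%E by rewrite lee_fin invr_ge0 ltW.
have clamp_ge0 i y : (0 <= (clamp01 (s%:R * x - j%:R - i%:R - y))%:E :> \bar R)%E.
  by rewrite lee_fin clamp01_ge0.
rewrite -sumEFin; apply: eq_bigr => i _; rewrite ge0_integralZl//.
by rewrite EFinM convolution_cdfE.
Qed.

End ConvolutionRefinable.

(* The conditions on [p] say that sum_k p_k z^k is
   (1 + z + ... + z^(s-1)) (p_0 + (p_1 - p_0) z + p_(s+1) z^2). *)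
Lemma sum_digit_convolution (R : realType) (s : nat) (p g : nat -> R) :
  (3 < s)%N ->
  (forall k : nat, (2 <= k <= s.-1)%N -> p k = s%:R^-1) ->
  p 0%N + p s = s%:R^-1 -> p 1%N + p s.+1 = s%:R^-1 ->
  \sum_(k < s.+2) p k * g k =
  p 0%N * \sum_(i < s) g i + (p 1%N - p 0%N) * \sum_(i < s) g i.+1
  + p s.+1 * \sum_(i < s) g i.+2.
Proof.
case: s => [//|[//|t]] _ pmid p0 p1.
rewrite (@big_ord_recr _ _ _ t.+3)/= (@big_ord_recr _ _ _ t.+2)/= 2!big_ord_recl/=.
rewrite (@big_ord_recl _ _ _ t.+1 (fun i => g i))/= big_ord_recl/=.
rewrite (@big_ord_recr _ _ _ t.+1 (fun i => g i.+1))/= big_ord_recl/=.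
rewrite (@big_ord_recr _ _ _ t.+1 (fun i => g i.+2))/= big_ord_recr/=.
rewrite /bump/= !add1n.
(* Here [s] is [t.+2], and [M] collects the terms of indices 2 to s - 1, common to all the sums. *)
set M := \sum_(i < t) g i.+2.
rewrite (_ : \sum_(i < t) p _ * _ = t.+2%:R^-1 * M); last first.
  rewrite mulr_sumr; apply: eq_bigr => i _; rewrite add1n pmid//=.
  by rewrite ltnS ltn_ord.
have -> : p t.+2 = t.+2%:R^-1 - p 0%N by rewrite -p0 [p 0%N + _]addrC addrK.
have -> : p t.+3 = t.+2%:R^-1 - p 1%N by rewrite -p1 [p 1%N + _]addrC addrK.
ring.
Qed.

Lemma radix_cdf_measure (R : realType) (s K : nat) (p : nat -> R) (B : R) :
  (1 < s)%N -> (forall k, (k < K)%N -> 0 <= p k) -> \sum_(k < K) p k = 1 ->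
  0 <= B -> (forall k, (k < K)%N -> k%:R + B <= s%:R * B) ->
  exists nu : probability R R,
    forall x, nu `]-oo, x]%classic = (radix_cdf s K p x)%:E.
Proof.
move=> s1 p0 psum B0 Bst; pose N := radix_cdf s K p.
have Nnd : nondecreasing N by move=> x y xy; exact: le_radix_cdf p0 psum _ _ xy.
have Nrc : right_continuous N by exact: radix_cdf_right_continuous s1 p0 psum.
have NNy : N @ -oo --> (0 : R).
  apply: cvg_near_cst; exists 0; split => // x x0.
  exact: (radix_cdf_lt0 s1 p0 psum x0).
have Ny : N @ +oo --> (1 : R).
  apply: cvg_near_cst; exists B; split => [|x /ltW Bx]; first exact: num_real.
  exact: (radix_cdf_ge s1 psum B0 Bst Bx).
pose f : cumulativeBounded (0 : R) (1 : R) := HB.pack N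
  (isCumulative.Build R _ R N Nnd Nrc) (isCumulativeBounded.Build R 0 1 N NNy Ny).
exists (distribution (lebesgue_stieltjes_measure f) (@from_borel R)) => x.
exact: (cdf_lebesgue_stieltjes_id f x).
Qed.

(** The two summands are the coordinates on the product of the uniform law and [nu]. *)
Lemma probability_cdf_uniform_summand (R : realType) d (T : measurableType d)
    (P : probability T R) (xi : {RV P >-> R}) (nu : probability R R) :
  (forall x, P (xi @^-1` `]-oo, x]%classic) = (convolution_cdf nu x)%:E) ->
  has_uniform_summand xi.
Proof.
move=> xi_cdf.
pose P' : probability (R * R)%type R := (uniform01_law R \x nu)%E.
pose tau : {RV P' >-> R} :=
  HB.pack (@fst R R) (isMeasurableFun.Build _ _ _ _ (@fst R R) measurable_fst).
pose eta : {RV P' >-> R} :=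
  HB.pack (@snd R R) (isMeasurableFun.Build _ _ _ _ (@snd R R) measurable_snd).
have P'X A B : measurable A -> measurable B ->
    P' (A `*` B) = (uniform01_law R A * nu B)%E.
  by move=> mA mB; rewrite /P' /= product_measure1E.
have tauE A : measurable A -> P' (tau @^-1` A) = uniform01_law R A.
  move=> mA; rewrite (_ : _ @^-1` _ = A `*` setT); last by apply/seteqP; split=> [z //|z []].
  by rewrite P'X// probability_setT mule1.
have etaE B : measurable B -> P' (eta @^-1` B) = nu B.
  move=> mB; rewrite (_ : _ @^-1` _ = setT `*` B); last by apply/seteqP; split=> [z //|z []].
  by rewrite P'X// probability_setT mul1e.
have ind : independent2 tau eta.
  by move=> A B mA mB; rewrite tauE// etaE// -P'X.
have unif : uniform01 tau by move=> A mA; exact: tauE.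
exists _, (R * R)%type, P', tau, eta; split => // A mA.
apply: (measure_eq_cdf (m1 := distribution P' (tau \+ eta)) (m2 := distribution P xi)) => // x.
rewrite [RHS]xi_cdf [LHS](uniform_sum_cdf ind unif) convolution_cdfE.
by apply: eq_measure_integral => B mB _; exact: etaE.
Qed.

Lemma radix_cdf_convolution (R : realType) (s : nat) (p : nat -> R) :
  (3 < s)%N -> (forall k, (k < s.+2)%N -> 0 <= p k) ->
  \sum_(k < s.+2) p k = 1 -> p 0%N <= p 1%N ->
  (forall k : nat, (2 <= k <= s.-1)%N -> p k = s%:R^-1) ->
  p 0%N + p s = s%:R^-1 -> p 1%N + p s.+1 = s%:R^-1 ->
  exists nu : probability R R, radix_cdf s s.+2 p = convolution_cdf nu.
Proof.
move=> s3 pge0 psum p01 pmid ps p1s.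
have s0 : 0 < s%:R :> R by rewrite ltr0n; lia.
have s4 : 4 <= s%:R :> R by rewrite (ler_nat R 4).
pose q k := s%:R * nth 0 [:: p 0%N; p 1%N - p 0%N; p s.+1] k.
have q_ge0 k : (k < 3)%N -> 0 <= q k.
  by case: k => [|[|[|//]]] _; apply: mulr_ge0; rewrite ?(ltW s0)//= ?subr_ge0//; exact: pge0.
have q_sum : \sum_(k < 3) q k = 1.
  rewrite !big_ord_recl big_ord0 /q/= addr0 -!mulrDr addrA subrKC p1s mulfV//.
  by rewrite gt_eqF.
have q_st k : (k < 3)%N -> k%:R + 1 <= s%:R * 1 :> R.
  move=> k3; have : k%:R <= 2%:R :> R by rewrite ler_nat; lia.
  by lra.
have [nu nuE] := radix_cdf_measure (ltac:(lia) : (1 < s)%N) q_ge0 q_sum ler01 q_st.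
have nu_cdf x : nu `]-oo, x]%classic =
    (\sum_(k < 3) (q k)%:E * nu `]-oo, (s%:R * x - k%:R)%R]%classic)%E.
  rewrite nuE (radix_cdf_refinable _ q_ge0 q_sum) ?sumEFin; [|lia].
  by rewrite -sumEFin; apply: eq_bigr => k _; rewrite nuE.
(* The convolution satisfies the same refinement equation as the radix distribution function. The
   bound 2 comes from both factors being carried by [0, 1]. *)
exists nu; apply/esym; apply: (@refinable_unique _ _ _ _ 2) => //; first lia.
- move=> x; rewrite (convolution_cdf_digits (ltac:(lia) : (0 < s)%N) q_ge0 nu_cdf).
  rewrite (sum_digit_convolution (fun k => convolution_cdf nu (s%:R * x - k%:R)) s3 pmid ps p1s).
  have qE j y : q j * (s%:R^-1 * y) = nth 0 [:: p 0%N; p 1%N - p 0%N; p s.+1] j * y.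
    by rewrite /q; field; rewrite gt_eqF.
  rewrite !big_ord_recl big_ord0 addr0 /= !mulr_sumr -[RHS]addrA.
  by congr (_ + (_ + _)); apply: eq_bigr => i _; rewrite qE /=;
    congr (_ * convolution_cdf _ _); rewrite ?subr0// /bump/= -addrA -opprD -natrD.
- exact: le_convolution_cdf.
- exact: convolution_cdf_right_continuous.
- move=> x x0; apply/eqP; rewrite eq_le; apply/andP; split.
    rewrite -lee_fin (le_trans (convolution_cdf_le nu x))// nuE.
    by rewrite (radix_cdf_lt0 _ q_ge0 q_sum x0)//; lia.
  rewrite -lee_fin convolution_cdfE; apply: integral_ge0 => y _.
  by rewrite lee_fin clamp01_ge0.
- move=> x x2; apply/eqP; rewrite eq_le; apply/andP; split.
    rewrite -lee_fin (le_trans (convolution_cdf_le nu x))//.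
    exact: probability_le1.
  rewrite -lee_fin; have := @convolution_cdf_ge R nu x 1 ltac:(lra).
  apply: le_trans; rewrite mul1e nuE (radix_cdf_ge _ q_sum ler01 q_st) ?lexx//; [lia|lra].
Qed.

(** * Fourier coefficients *)

Section FourierUniform.
Context {R : realType}.

Lemma is_derive_sin_affine (w c x : R) : w != 0 ->
  is_derive x 1 (fun x => x + w^-1 * sin (w * x + c)) (1 + cos (w * x + c)).
Proof.
move=> w0; have dw : is_derive x 1 (fun y : R => w * y + c) w.
  by apply: is_derive_eq; rewrite addr0 -[RHS]mulr1.
have ds : is_derive x 1 (sin \o (fun y : R => w * y + c)) (cos (w * x + c) * w).
  exact: is_derive1_comp.
have := is_deriveD (is_derive_id x 1) (is_deriveZ (w^-1) ds).
by rewrite -[_ *: _]/(_ * _) mulrCA mulVf// mulr1.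
Qed.

Lemma continuous_cos_affine (w c : R) : continuous (fun x : R => cos (w * x + c)).
Proof.
move=> x; apply: continuous_comp; last exact: continuous_cos.
apply: cvgD; last exact: cvg_cst.
apply: cvgM; [exact: cvg_cst|exact: cvg_id].
Qed.
(** Adding 1 makes the integrand nonnegative, so that Tonelli and the self-similarity formula apply
    without integrability conditions; the phase [c] lets one real function encode both cosine and
    sine. *)
Lemma one_cos_affine_ge0 (w c x : R) :
  (0 <= (1 + cos (w * x + c))%:E :> \bar R)%E.
Proof. by rewrite lee_fin; have := cos_geN1 (w * x + c); lra. Qed.

Lemma measurable_one_cos_affine (w c : R) :
  measurable_fun setT (fun x : R => (1 + cos (w * x + c))%:E).
Proof.
apply/measurable_EFinP; apply: continuous_measurable_fun => x.
by apply: cvgD; [exact: cvg_cst|exact: continuous_cos_affine].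
Qed.

Lemma integral_uniform01_cos (w c : R) : w != 0 ->
  (\int[uniform01_law R]_x (1 + cos (w * x + c))%:E =
   (1 + w^-1 * (sin (w + c) - sin c))%:E)%E.
Proof.
move=> w0.
have f0 := one_cos_affine_ge0 w c; have mf := measurable_one_cos_affine w c.
have cf : continuous (fun x : R => 1 + cos (w * x + c)).
  by move=> x; apply: cvgD; [exact: cvg_cst|exact: continuous_cos_affine].
rewrite ge0_integral_distribution// integral_uniform// subr0 invr1 mul1e.
have dF x := is_derive_sin_affine c x w0.
rewrite (@continuous_FTC2 _ _ (fun x : R => x + w^-1 * sin (w * x + c)))//.
- by rewrite -EFinD mulr1 mulr0 !add0r mulrBr addrA.
- exact: continuous_subspaceT.
- have cF : continuous (fun x : R => x + w^-1 * sin (w * x + c)).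
    by move=> x; apply: differentiable_continuous; apply/derivable1_diffP; case: (dF x).
  split.
  + by move=> x _; case: (dF x).
  + by apply: cvg_at_right_filter; exact: cF.
  + by apply: cvg_at_left_filter; exact: cF.
- by move=> x _; rewrite derive1E; case: (dF x).
Qed.

End FourierUniform.

(** For each value of [eta], the integral over [tau] covers [m] full periods, so the cosine averages
    to 0. *)
Lemma uniform_summand_cos (R : realType) d (T : measurableType d)
    (P : probability T R) (tau eta : {RV P >-> R}) (m : nat) (c : R) :
  independent2 tau eta -> uniform01 tau -> (0 < m)%N ->
  (\int[distribution P (tau \+ eta)%R]_x (1 + cos ((pi *+ 2 *+ m) * x + c))%:E = 1)%E.
Proof.
move=> ind unif m0; set w := pi *+ 2 *+ m.
have w0 : w != 0 by apply: lt0r_neq0; rewrite /w pmulrn_lgt0// pmulrn_lgt0// pi_gt0.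
have f0 := one_cos_affine_ge0 w c; have mf := measurable_one_cos_affine w c.
rewrite (ge0_integral_uniform_sum ind unif mf f0).
rewrite (eq_integral (cst 1%:E)); first exact: integral_probability_cst.
move=> y _ /=; under eq_integral do rewrite mulrDr -addrA.
rewrite integral_uniform01_cos// [w + _]addrC periodicn; last exact: sinD2pi.
by rewrite subrr mulr0 addr0.
Qed.

Section Cis.
Context {R : realType}.

Local Open Scope complex_scope.

Definition cis (t : R) : R[i] := cos t +i* sin t.

Lemma cisX (t : R) k : cis t ^+ k = cis (k%:R * t).
Proof.
elim: k => [|k IH]; first by rewrite mul0r /cis cos0 sin0.
rewrite exprS IH -natr1 mulrDl mul1r addrC /cis cosD sinD.
by apply/eqP; rewrite eq_complex /= !eqxx /=; apply/eqP; ring.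
Qed.

Lemma cis_periodic (t : R) k : cis (t + pi *+ 2 *+ k) = cis t.
Proof. by rewrite /cis (periodicn (@cosD2pi R)) (periodicn (@sinD2pi R)). Qed.

(** Equality gives 1 = cos (2 pi (x - y)) = 1 - 2 sin^2 (pi (x - y)), whereas the sine is positive
    when 0 < x - y < 1. *)
Lemma cis_inj (x y : R) : 0 <= x < 1 -> 0 <= y < 1 ->
  cis (pi *+ 2 * x) = cis (pi *+ 2 * y) -> x = y.
Proof.
wlog yx : x y / y <= x.
  move=> H x01 y01 e; have [/H|/ltW/H] := leP y x; first exact.
  by move=> h; apply/esym/h.
move=> /andP[x0 x1] /andP[y0 y1] [ec es]; apply/eqP; rewrite eq_le yx andbT leNgt.
apply/negP => xy; have pi0 := @pi_gt0 R.
have c1 : cos (pi * (x - y) + pi * (x - y)) = 1.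
  have -> : pi * (x - y) + pi * (x - y) = pi *+ 2 * x - pi *+ 2 * y by rewrite mulr2n; ring.
  by rewrite cosB ec es -!expr2 cos2Dsin2.
have : 0 < sin (pi * (x - y)) by apply: sin_gt0_pi; apply/andP; split; nra.
move: c1; rewrite cosD -!expr2 cos2sin2; nra.
Qed.

End Cis.

(** * Characteristic functions of self-similar laws *)

Section CharacteristicFunction.
Context {R : realType}.
Variables (mu : probability R R).

Definition fourier_cos (t : R) : R := \int[mu]_x cos (t * x).
Definition fourier_sin (t : R) : R := \int[mu]_x sin (t * x).
Local Notation C := fourier_cos.
Local Notation S := fourier_sin.

Let bounded_integrable (g : R -> R) : continuous g -> (forall x, `|g x| <= 1) ->
  mu.-integrable setT (fun x => (g x)%:E).
Proof.
move=> cg g1; apply: (@measurable_bounded_integrable _ _ _ mu g setT) => //.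
- by rewrite (le_lt_trans (probability_le1 mu _)) ?ltry.
- exact: continuous_measurable_fun.
- exists 1; split; first exact: num_real.
  by move=> M M1 x _; apply: le_trans (g1 x) _; exact: ltW.
Qed.

Let mulr_continuous t : continuous (fun x : R => t * x).
Proof. by move=> x; apply: cvgM; [exact: cvg_cst|exact: cvg_id]. Qed.

Let integrable_cos t : mu.-integrable setT (fun x => (cos (t * x))%:E).
Proof.
apply: bounded_integrable => x; last by rewrite ler_norml cos_geN1 cos_le1.
apply: (@continuous_comp _ _ _ (fun x => t * x) cos); first exact: mulr_continuous.
exact: continuous_cos.
Qed.

Let integrable_sin t : mu.-integrable setT (fun x => (sin (t * x))%:E).
Proof.
apply: bounded_integrable => x; last by rewrite ler_norml sin_geN1 sin_le1.
apply: (@continuous_comp _ _ _ (fun x => t * x) sin); first exact: mulr_continuous.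
exact: continuous_sin.
Qed.

Lemma integral_cos_affine (t c : R) :
  (\int[mu]_x (1 + cos (t * x + c))%:E =
   (1 + (cos c * C t - sin c * S t))%:E)%E.
Proof.
have EC : (\int[mu]_x (cos (t * x))%:E = (C t)%:E)%E.
  by rewrite fineK//; exact: integrable_fin_num.
have ES : (\int[mu]_x (sin (t * x))%:E = (S t)%:E)%E.
  by rewrite fineK//; exact: integrable_fin_num.
have iC := integrableZl measurableT (cos c) (integrable_cos t).
have iS := integrableZl measurableT (sin c) (integrable_sin t).
transitivity (\int[mu]_x (cst 1%:E x +
    ((cos c)%:E * (cos (t * x))%:E - (sin c)%:E * (sin (t * x))%:E)))%E.
  apply: eq_integral => x _; rewrite cosD [cos _ * cos c]mulrC [sin _ * sin c]mulrC.
  by rewrite /= !EFinD EFinN !EFinM.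
rewrite integralD//; last 2 first.
- exact: finite_measure_integrable_cst.
- exact: integrableB.
rewrite integralB// !integralZl// EC ES integral_probability_cst.
by rewrite !EFinD EFinN !EFinM.
Qed.

Section SelfSimilarCharacteristicFunction.
Variables (s K : nat) (p : nat -> R).
Hypothesis s_gt0 : (0 < s)%N.
Hypothesis p_ge0 : forall k, (k < K)%N -> 0 <= p k.
Hypothesis p_sum : \sum_(k < K) p k = 1.
Hypothesis mu_cdf : forall x : R, mu `]-oo, x]%classic =
  (\sum_(k < K) (p k)%:E * mu `]-oo, (s%:R * x - k%:R)%R]%classic)%E.

Let cos_affine_refine t c : cos c * C (s%:R * t) - sin c * S (s%:R * t) =
  \sum_(k < K) p k * (cos (k%:R * t + c) * C t - sin (k%:R * t + c) * S t).
Proof.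
have s0 : s%:R != 0 :> R by rewrite pnatr_eq0 -lt0n.
apply: (addrI 1); apply: EFin_inj; rewrite -integral_cos_affine.
rewrite (ge0_self_similar_integral s_gt0 p_ge0 mu_cdf
  (measurable_one_cos_affine _ _) (one_cos_affine_ge0 _ _)).
have split1 (E : 'I_K -> R) : 1 + \sum_(k < K) p k * E k = \sum_(k < K) p k * (1 + E k).
  by under [RHS]eq_bigr do rewrite mulrDr mulr1; rewrite big_split/= p_sum.
rewrite split1 -sumEFin; apply: eq_bigr => k _.
rewrite EFinM -integral_cos_affine; congr (_ * _)%E.
apply: eq_integral => x _; congr ((1 + cos _)%R%:E). field.
exact: s0.
Qed.

Local Open Scope complex_scope.

Definition char_fun (t : R) : R[i] := C t +i* S t.

Definition digit_poly : {poly R[i]} := \poly_(k < K) (p k)%:C.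

Lemma char_fun_refine t :
  char_fun (s%:R * t) = digit_poly.[cis t] * char_fun t.
Proof.
rewrite /digit_poly horner_poly mulr_suml.
have -> : \sum_(k < K) (p k)%:C * cis t ^+ k * char_fun t =
   (\sum_(k < K) p k * (cos (k%:R * t) * C t - sin (k%:R * t) * S t)) +i*
   (\sum_(k < K) p k * (sin (k%:R * t) * C t + cos (k%:R * t) * S t)).
  elim/big_rec3: _ => // k x y z _ ->; rewrite cisX /cis /char_fun.
  by apply/eqP; rewrite eq_complex /=; apply/andP; split; apply/eqP; ring.
(* The phase 0 yields the real part and the phase -pi/2 the imaginary part. *)
have := cos_affine_refine t 0; rewrite cos0 sin0 mul1r mul0r subr0 => HC.
have := cos_affine_refine t (- (pi / 2)).
rewrite cosN cos_pihalf mul0r sinN sin_pihalf mulN1r add0r opprK => HS.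
rewrite /char_fun HC HS; apply/eqP; rewrite eq_complex /=; apply/andP; split; apply/eqP.
  by apply: eq_bigr => k _; rewrite addr0.
apply: eq_bigr => k _; rewrite cosBpihalf.
rewrite sinBpihalf; ring.
Qed.

End SelfSimilarCharacteristicFunction.

End CharacteristicFunction.

Section NonVanishing.
Context {R : realType}.
Variable mu : probability R R.

(** On ]-1, 2] and for 0 <= t <= 1/2, the product [t * x] stays in [-1, 1], so the mean of 1 + cos
    (t x) is at least 1 + cos 1 > 1; a zero of the characteristic function would make it 1. *)
Lemma char_fun_neq0 (t : R) :
  mu `]-oo, (- 1)%R]%classic = 0%E -> mu `]-oo, 2%R]%classic = 1%E ->
  0 <= t <= 2^-1 -> char_fun mu t != 0.
Proof.
move=> mu0 mu1 /andP[t0 t1]; apply/eqP => -[Ct _].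
have mI (a b : itv_bound R) : measurable [set` Interval a b] by exact: measurable_itv.
have muD : mu `]-1, 2]%classic = 1%E.
  have -> : `]-1, 2]%classic = `]-oo, 2] `\` `]-oo, (-1 : R)]%classic :> set R.
    by apply/seteqP; split => x; rewrite /= !in_itv/=; lra.
  rewrite measureD//; last by rewrite (le_lt_trans (probability_le1 mu _)) ?ltry.
  have -> : `]-oo, 2] `&` `]-oo, (-1 : R)] = `]-oo, (-1 : R)]%classic :> set R.
    by apply/seteqP; split => x; rewrite /= !in_itv/=; lra.
  by rewrite -[RHS]sube0; congr (_ - _)%E; [exact: mu1|exact: mu0].
have := integral_cos_affine mu t 0.
rewrite cos0 sin0 mul1r mul0r subr0 Ct addr0 => int1.
have f0 := one_cos_affine_ge0 t 0; have mf := measurable_one_cos_affine t 0.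
have : ((1 + cos 1)%:E <= (1 : R)%:E)%E; last first.
  by rewrite lee_fin; have := @cos1_gt0 R; lra.
rewrite -int1; apply: (@le_trans _ _
  (\int[mu]_(x in `](-1)%R, 2%R]) (1 + cos (t * x + 0))%:E)%E); last first.
  exact: ge0_subset_integral.
have <- : (\int[mu]_(x in `](-1)%R, 2%R]) (cst (1 + cos 1)%:E x) = (1 + cos 1)%:E)%E.
  by rewrite integral_cst// -[RHS]mule1; congr (_ * _)%E; exact: muD.
apply: ge0_le_integral => //.
- by move=> x _; rewrite lee_fin; have := @cos1_gt0 R; lra.
- exact: measurable_funTS.
move=> x; rewrite /= in_itv/= => /andP[x1 x2].
rewrite lee_fin lerD2l addr0; have p2 := @pi_ge2 R.
have [x0|x0] := leP 0 (t * x).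
  by rewrite leNgt ltr_cos ?in_itv/= -?leNgt; nra.
rewrite -[t * x]opprK cosN.
by rewrite leNgt ltr_cos ?in_itv/= -?leNgt; nra.
Qed.

End NonVanishing.

(** Without such a root, the zero at [t] would propagate to every t / s^k, hence arbitrarily close
    to 0. *)
Lemma char_fun_root (R : realType) (mu : probability R R) (s K : nat) (p : nat -> R) (t : R) :
  (1 < s)%N -> (forall k, (k < K)%N -> 0 <= p k) -> \sum_(k < K) p k = 1 ->
  (forall x : R, mu `]-oo, x]%classic =
    (\sum_(k < K) (p k)%:E * mu `]-oo, (s%:R * x - k%:R)%R]%classic)%E) ->
  mu `]-oo, (- 1)%R]%classic = 0%E -> mu `]-oo, 2%R]%classic = 1%E ->
  0 <= t -> char_fun mu t = 0 ->
  exists2 k, (0 < k)%N & root (digit_poly K p) (cis (t / s%:R ^+ k)).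
Proof.
move=> s1 p0 psum mu_cdf mu0 mu1 t0 phi0; apply: contrapT => noroot.
have s0 : 0 < s%:R :> R by rewrite ltr0n; lia.
have phi k : char_fun mu (t / s%:R ^+ k) = 0.
  elim: k => [|k IH]; first by rewrite expr0 divr1.
  have := char_fun_refine (ltac:(lia) : (0 < s)%N) p0 psum mu_cdf (t / s%:R ^+ k.+1).
  have -> : s%:R * (t / s%:R ^+ k.+1) = t / s%:R ^+ k.
    by rewrite exprS; field; rewrite expf_neq0 gt_eqF.
  rewrite IH => /esym/eqP; rewrite mulf_eq0 => /orP[rk|/eqP//].
  by case: noroot; exists k.+1.
(* From 2 t < n <= s^n follows t / s^n <= 1/2, the range where the characteristic function does not
   vanish. *)
pose n := Num.bound (2 * t).
have : char_fun mu (t / s%:R ^+ n) != 0.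
  apply: char_fun_neq0 => //; rewrite divr_ge0 ?exprn_ge0 ?(ltW s0)//=.
  rewrite ler_pdivrMr ?exprn_gt0//.
  have : 2 * t < n%:R by apply: archi_boundP; rewrite mulr_ge0.
  have : n%:R <= s%:R ^+ n :> R by rewrite -natrX ler_nat; apply/ltnW/ltn_expl.
  by lra.
by rewrite phi eqxx.
Qed.

(** * Roots of the digit polynomial *)

Section RootCounting.
Context {R : realType}.
Variables (s : nat) (p : nat -> R).
Hypothesis s_gt3 : (3 < s)%N.
Hypothesis p_sum : \sum_(k < s.+2) p k = 1.

Local Open Scope complex_scope.
Local Notation Q := (digit_poly s.+2 p).

Hypothesis Q_root : forall m : nat, (0 < m)%N ->
  exists2 k, (0 < k)%N & root Q (cis (pi *+ 2 *+ m / s%:R ^+ k)).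

Let s0 : 0 < s%:R :> R. Proof. by rewrite ltr0n; lia. Qed.

Let Q_neq0 : Q != 0.
Proof.
apply/eqP => Q0; have : Q.[1] = 0 by rewrite Q0 horner0.
rewrite horner_poly; under eq_bigr do rewrite expr1n mulr1.
by rewrite -raddf_sum p_sum => /eqP; rewrite oner_eq0.
Qed.

(* If the residue [a] is not covered by a root of level 1, then each of the
   [s] numbers [a + s * j] needs its own root of level at least 2, which
   together with the other residues exceeds the degree as soon as [3 < s]. *)
Lemma digit_poly_root_level1 a : (0 < a < s)%N ->
  root Q (cis (pi *+ 2 *+ a / s%:R)).
Proof.
move=> /andP[a0 a_s]; apply: contrapT => nroot.
have /choice[k kP] (m : nat) : exists k, (0 < m)%N ->
    (0 < k)%N /\ root Q (cis (pi *+ 2 *+ m / s%:R ^+ k)).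
  case: (posnP m) => [->|m0]; first by exists 0%N.
  by have [k k0 rk] := Q_root m0; exists k.
(* These are 2 (s - 1) integers, to be turned into as many roots; the degree is at most s + 1 < 2 (s
   - 1). [theta m] is the argument of the root of [m], in turns. *)
pose M := iota 1 s.-1 ++ [seq (a + s * j)%N | j <- iota 1 s.-1].
pose theta m : R := m%:R / s%:R ^+ k m.
have MP m : m \in M -> [/\ (0 < m)%N, ~~ (s %| m)%N & (m < s ^ k m)%N].
  rewrite mem_cat mem_iota => /orP[/andP[m1 ms]|/mapP[j]].
    have m_s : (m < s)%N by lia.
    split=> //; first by rewrite gtnNdvd.
    have [k0 _] := kP m m1; apply: leq_trans m_s _.
    by rewrite -{1}(expn1 s) leq_exp2l//; lia.
  rewrite mem_iota => /andP[j1 js] m_def.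
  have m0 : (0 < m)%N by lia.
  split => //; first by rewrite m_def dvdn_addl ?dvdn_mulr// gtnNdvd.
  have [k0 rk] := kP m m0.
  (* At level 1, a + s j would give the same point as [a], by periodicity. Level at least 2 also
     ensures [m < s ^ k m], hence [theta m < 1]. *)
  have k2 : (1 < k m)%N.
    rewrite ltn_neqAle k0 andbT; apply/eqP => k1; apply: nroot.
    move: rk; rewrite -k1 expr1 m_def mulrnDr mulrnA mulrDl.
    have -> : pi *+ 2 *+ s *+ j / s%:R = pi *+ 2 *+ j :> R.
      by rewrite -(mulr_natr (pi *+ 2) s) mulrnAl mulfK ?gt_eqF.
    by rewrite cis_periodic.
  have : (m < s ^ 2)%N by rewrite m_def expnS expn1; nia.
  by move=> /leq_trans; apply; rewrite leq_exp2l//; lia.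
have theta01 m : m \in M -> 0 <= theta m < 1.
  move=> /MP[_ _ ms]; rewrite divr_ge0 ?exprn_ge0 ?(ltW s0)//=.
  by rewrite ltr_pdivrMr ?exprn_gt0// mul1r -natrX ltr_nat.
(* Equal angles give m' = m s^(k m' - k m); as [s] does not divide [m'], the exponent is 0. *)
have theta_inj : {in M &, injective theta}.
  suff main : forall m m', m \in M -> m' \in M -> (k m <= k m')%N ->
      theta m = theta m' -> m = m'.
    move=> m m' mM m'M e; have [h|/ltnW h] := leqP (k m) (k m'); first exact: main.
    by apply/esym/main.
  move=> m m' mM m'M kk e.
  have : (m * s ^ (k m' - k m) = m')%N.
    apply/eqP; rewrite -(eqr_nat R) natrM natrX; apply/eqP.
    move: e; rewrite /theta -(subnK kk) addnK exprD.
    have x0 : s%:R ^+ (k m' - k m) != 0 :> R by rewrite expf_neq0 ?gt_eqF.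
    have y0 : s%:R ^+ k m != 0 :> R by rewrite expf_neq0 ?gt_eqF.
    move/(congr1 (fun z => z * (s%:R ^+ (k m' - k m) * s%:R ^+ k m))).
    rewrite [RHS]mulfVK ?mulf_neq0// => <-; field.
    exact: y0.
  case: (k m' - k m)%N => [|n]; first by rewrite muln1.
  have [_ /negP ndvd _] := MP _ m'M.
  by move=> e'; case: ndvd; rewrite -e' expnS mulnCA dvdn_mulr.
have uniqM : uniq M.
  rewrite cat_uniq iota_uniq/= map_inj_uniq ?iota_uniq ?andbT; last first.
    by move=> i j; nia.
  by apply/hasPn => _ /mapP[j + ->]; rewrite !mem_iota => ?; nia.
pose rs := [seq cis (pi *+ 2 * theta m) | m <- M].
have rootrs : all (root Q) rs.
  apply/allP => _ /mapP[m mM ->]; have [m0 _ _] := MP m mM.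
  by have [_] := kP m m0; rewrite /theta mulrA mulr_natr.
have uniqrs : uniq rs.
  rewrite map_inj_in_uniq// => m m' mM m'M /(cis_inj (theta01 m mM) (theta01 m' m'M)).
  exact: theta_inj.
have := max_poly_roots Q_neq0 rootrs uniqrs.
have : (size Q <= s.+2)%N by exact: size_poly.
rewrite size_map size_cat size_map !size_iota => h1 h2.
by have := leq_trans h2 h1; lia.
Qed.

(** Modulo X^s - 1 the polynomial folds to the class sums [c r]. Both it and 1 + X + ... + X^(s-1)
    vanish at the nontrivial s-th roots of unity; subtracting the multiple [l] that kills the top
    coefficient leaves [Q'], of degree at most s - 2 with s - 1 roots. So all the [c r] are equal,
    and they sum to 1. *)
Lemma digit_class_sums :
  [/\ forall k : nat, (2 <= k <= s.-1)%N -> p k = s%:R^-1,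
      p 0%N + p s = s%:R^-1 & p 1%N + p s.+1 = s%:R^-1].
Proof.
pose c r := p r + (if r == 0%N then p s else if r == 1%N then p s.+1 else 0).
pose l := c s.-1.
have eval (z : R[i]) : \sum_(r < s) (c r)%:C * z ^+ r =
    \sum_(r < s) (p r)%:C * z ^+ r + (p s)%:C + (p s.+1)%:C * z.
  have -> : s = s.-2.+2 by lia.
  rewrite !big_ord_recl /= /c /= !rmorphD/=.
  rewrite (eq_bigr (fun i : 'I_(s.-2) =>
    (p (bump 0 (bump 0 i)))%:C * z ^+ bump 0 (bump 0 i))); last first.
    by move=> i _; rewrite /= addr0.
  have -> : s.-2.+2 = s by lia.
  by rewrite /bump /= !expr0 expr1; ring.
pose Q' : {poly R[i]} := \poly_(r < s.-1) (c r - l)%:C.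
pose w (a : nat) : R[i] := cis (pi *+ 2 * (a%:R / s%:R)).
have horner_Q z : z ^+ s = 1 -> Q.[z] = \sum_(r < s) (c r)%:C * z ^+ r.
  by move=> zs; rewrite horner_poly eval !big_ord_recr/= exprS zs !mulr1.
have w_pow a : w a ^+ s = 1.
  rewrite cisX (_ : _ * _ = 0 + pi *+ 2 *+ a); last first.
    by rewrite -[in RHS]mulr_natr; field; rewrite gt_eqF.
  by rewrite cis_periodic /cis cos0 sin0.
have w_inj a b : (a < s)%N -> (b < s)%N -> w a = w b -> a = b.
  have lt01 n : (n < s)%N -> 0 <= (n%:R / s%:R : R) < 1.
    by move=> ns; rewrite divr_ge0 ?(ltW s0)//= ltr_pdivrMr// mul1r ltr_nat.
  move=> /lt01 a_s /lt01 b_s /(cis_inj a_s b_s)/(congr1 ( *%R^~ s%:R)).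
  by rewrite !divfK ?gt_eqF// => /eqP; rewrite eqr_nat => /eqP.
have root_w a : (0 < a < s)%N -> root Q' (w a).
  move=> /andP[a0 a_s]; rewrite /root horner_poly.
  have sumw : \sum_(r < s) w a ^+ r = 0.
    have w1 : w a - 1 != 0.
      rewrite subr_eq0; apply/eqP => wa1; have : w a = w 0%N.
        by rewrite wa1 /w mul0r mulr0 /cis cos0 sin0.
      by move/w_inj => h; move: a0; rewrite h//; lia.
    by apply: (mulfI w1); rewrite -subrX1 w_pow subrr mulr0.
  have := digit_poly_root_level1 (ltac:(lia) : (0 < a < s)%N).
  have -> : pi *+ 2 *+ a / s%:R = pi *+ 2 * (a%:R / s%:R) :> R.
    by rewrite mulrA mulr_natr.
  rewrite -/(w a) /root horner_Q// => /eqP sumc.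
  transitivity (\sum_(r < s.-1.+1) (c r - l)%:C * w a ^+ r == 0).
    by rewrite big_ord_recr/= /l subrr mul0r addr0.
  have -> : s.-1.+1 = s by lia.
  under eq_bigr do rewrite rmorphB/= mulrBl.
  by rewrite sumrB sumc -mulr_sumr sumw mulr0 subr0 eqxx.
have Q'0 : Q' = 0.
  apply/eqP/negPn/negP => Q'n0; pose rs := [seq w a | a <- iota 1 s.-1].
  have rootrs : all (root Q') rs.
    by apply/allP => _ /mapP[a + ->]; rewrite mem_iota => ?; apply: root_w; lia.
  have uniqrs : uniq rs.
    rewrite map_inj_in_uniq ?iota_uniq// => a b; rewrite !mem_iota => ? ?.
    by apply: w_inj; lia.
  have := max_poly_roots Q'n0 rootrs uniqrs.
  by rewrite size_map size_iota ltnNge size_poly.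
have cl r : (r < s)%N -> c r = l.
  move=> rs; have [->//|rs1] := eqVneq r s.-1.
  have : Q'`_r = 0 by rewrite Q'0 coef0.
  have rs2 : (r < s.-1)%N by lia.
  by rewrite coef_poly rs2 => -[/eqP]; rewrite subr_eq0 => /eqP.
have lE : l = s%:R^-1.
  have := horner_Q 1 (expr1n _ _); rewrite horner_poly.
  under eq_bigr do rewrite expr1n mulr1; under [RHS]eq_bigr do rewrite expr1n mulr1.
  rewrite -!raddf_sum p_sum => -[]; under eq_bigr do rewrite cl//.
  rewrite sumr_const card_ord => h; apply: (mulIf (lt0r_neq0 s0)).
  by rewrite mulVf ?gt_eqF// mulr_natr -h.
split.
- move=> k /andP[k2 ks]; rewrite -lE -(cl k); last by lia.
  by rewrite /c; case: k k2 ks => [|[|k]]//=; rewrite addr0.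
- by rewrite -lE -(cl 0%N)//; lia.
- by rewrite -lE -(cl 1%N)//; lia.
Qed.

End RootCounting.

(** * Equivalence of the digit conditions with a uniform summand *)

Theorem theorem3 (R : realType) (s : nat) (p : nat -> R)
    (d : measure_display) (T : measurableType d) (P : probability T R)
    (xin : nat -> {RV P >-> R}) (xi : {RV P >-> R}) :
  (3 < s)%N ->
  (forall k : nat, (k <= s.+1)%N -> 0 <= p k < 1) ->
  \sum_(k < s.+2) p k = 1 ->
  mutually_independent xin ->
  (forall n k : nat, (k <= s.+1)%N ->
     distribution P (xin n) [set k%:R] = (p k)%:E) ->
  is_radix_sum s xin xi ->
  has_uniform_summand xi <->
  [/\ p 0%N <= p 1%N,
      forall k : nat, (2 <= k <= s.-1)%N -> p k = s%:R^-1,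
      p 0%N + p s = s%:R^-1 &
      p 1%N + p s.+1 = s%:R^-1].
Proof.
move=> s3 p01 p_sum xin_indep xin_p xin_xi.
have s_gt0 : (0 < s)%N by lia.
have s_gt1 : (1 < s)%N by lia.
have s4 : 4 <= s%:R :> R by rewrite (ler_nat R 4).
have p_ge0 k : (k < s.+2)%N -> 0 <= p k by move=> /p01/andP[].
have xi_cdf : forall x, P (xi @^-1` `]-oo, x]%classic) = (radix_cdf s s.+2 p x)%:E.
  by apply: (cdf_radix_sum s_gt0 p_sum xin_indep) => // n k ks; exact: xin_p.
split; last first.
  case=> p0p1 p_mid ps ps1.
  have [nu nuE] := radix_cdf_convolution s3 p_ge0 p_sum p0p1 p_mid ps ps1.
  by apply: (@probability_cdf_uniform_summand _ _ _ _ _ nu) => x; rewrite xi_cdf nuE.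
case=> d' [T' [P' [tau [eta [ind unif law_eq]]]]].
have F_refinable := radix_cdf_refinable (p := p) s_gt1 p_ge0 p_sum.
have F_mono := le_radix_cdf s_gt1 p_ge0 p_sum.
have F_lt0 := radix_cdf_lt0 s_gt1 p_ge0 p_sum.
(* The largest possible value of [xi] is (s + 1) / (s - 1), at most 5/3 for s >= 4. *)
have B_ge0 : 0 <= 5 / 3 :> R by lra.
have B_stable k : (k < s.+2)%N -> k%:R + 5 / 3 <= s%:R * (5 / 3) :> R.
  by move=> ks; have : k%:R <= s%:R + 1 :> R; [rewrite natr1 ler_nat|lra].
have F_ge := radix_cdf_ge s_gt1 p_sum B_ge0 B_stable.
set F := radix_cdf s s.+2 p in xi_cdf F_refinable F_mono F_lt0 F_ge.
pose mu : probability R R := distribution P' (tau \+ eta)%R.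
have mu_F x : mu `]-oo, x]%classic = (F x)%:E.
  by rewrite -xi_cdf -[RHS]law_eq//; exact: measurable_itv.
have mu_cdf x : mu `]-oo, x]%classic =
    (\sum_(k < s.+2) (p k)%:E * mu `]-oo, (s%:R * x - k%:R)%R]%classic)%E.
  by rewrite mu_F F_refinable -sumEFin; apply: eq_bigr => k _; rewrite mu_F.
have mu_N1 : mu `]-oo, (- 1)%R]%classic = 0%E by rewrite mu_F F_lt0//; lra.
have mu_2 : mu `]-oo, 2%R]%classic = 1%E by rewrite mu_F F_ge//; lra.
have phi0 m : (0 < m)%N -> char_fun mu (pi *+ 2 *+ m) = 0.
  move=> m0; have int1 c := uniform_summand_cos c ind unif m0.
  have trig0 c : cos c * fourier_cos mu (pi *+ 2 *+ m)
      - sin c * fourier_sin mu (pi *+ 2 *+ m) = 0.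
    have := int1 c; rewrite integral_cos_affine => -[e].
    by apply: (addrI 1); rewrite e addr0.
  (* The phases 0 and pi/2 isolate the cosine and sine coefficients. *)
  have := trig0 0; have := trig0 (pi / 2).
  rewrite cos0 sin0 cos_pihalf sin_pihalf !mul0r !mul1r subr0 sub0r => /eqP.
  by rewrite oppr_eq0 /char_fun => /eqP -> ->.
have Q_root m : (0 < m)%N ->
    exists2 k, (0 < k)%N & root (digit_poly s.+2 p) (cis (pi *+ 2 *+ m / s%:R ^+ k)).
  move=> m0; apply: (char_fun_root s_gt1 p_ge0 p_sum mu_cdf mu_N1 mu_2 _ (phi0 m m0)).
  by do 2 apply: mulrn_wge0; exact: pi_ge0.
have [p_mid ps ps1] := digit_class_sums s3 p_sum Q_root.
split=> //.
have /andP[_ p0_lt1] := p01 0%N isT.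
(* The law of [eta] serves as [nu]: [F] is its convolution with the uniform law. *)
apply: (refinable_convolution_le01 (nu := distribution P' eta) s3 p_ge0 p0_lt1 p_mid
  F_refinable F_mono F_lt0 F_ge) => x.
apply: EFin_inj; rewrite -mu_F convolution_cdfE.
exact: (uniform_sum_cdf ind unif).
Qed.
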